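(* Assume: 1. the family $(\mathrm P_\theta^T,\ \theta\in\Theta)$, $T\ge 0$, where $\mathrm P_\theta^T$ is the distribution of $X_{(T)}=(X_t,\ 0\le t\le T)$ under $\mathrm P_\theta$, is LAN at every $\theta\in\Theta$ with rate $c_T=T^{-1/2}$ and asymptotic information matrix $I(\theta)$; 2. for every $\theta\in\Theta$ and for $\mu_\theta$-almost every $x\in E$, there is a centered distribution $L(x,\theta)$ on $\mathbb R^k$ with finite variance such that for all $u\in\mathbb R^d$, under $\mathrm P^T_{\theta+u/\sqrt T}$, $\sqrt T\big(\widehat r_T(x)-r(x,\theta+u/\sqrt T)\big)$ converges in distribution to $L(x,\theta)$ as $T\to\infty$; 3. for every $\theta\in\Theta$ the limits $\lim_{T\to\infty}T\rho_T(\theta)$ and $\lim_{T\to\infty}TR_T(\theta)$ exist, are finite, non zero and equal. Then for all $\theta\in\Theta$ and all $y\in\mathbb R^k$, $$\lim_{T\to\infty} T\, y'R_T(\theta)\,y\ \ge\ y'\left(\int_E (\mathrm J_\theta r(x,\theta))\, I(\theta)^{-1} (\mathrm J_\theta r(x,\theta))'\, d\mu_\theta(x)\right) y .$$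
   Context: Setting. $(X_t,\ t\in\mathcal T)$, with $\mathcal T=\mathbb N$ or $\mathbb R_+$, is a random process with values in a measurable space $(E,\mathcal B)$, with distribution $\mathrm P_\theta$, $\theta\in\Theta\subset\mathbb R^d$ unknown. At time $T$ the path $X_{(T)}=(X_t,\ 0\le t\le T)$ is observed. $(Y_t)$ is an $\mathbb R^k$-valued process, and $r(x,\theta)=\mathrm E_\theta(Y_T\mid X_T=x)$ is assumed not to depend on $T$. The function $(x,\theta)\mapsto r(x,\theta)\in\mathbb R^k$ is measurable and, for each $x\in E$, $\theta\mapsto r(x,\theta)$ is differentiable on $\Theta$ with Jacobian matrix $\mathrm J_\theta r(x,\theta)$ ($k\times d$). $\mu_\theta$ is a measure on $(E,\mathcal B)$ not depending on $T$, and $r(\cdot,\theta),\ \mathrm J_\theta r(\cdot,\theta)\in \mathrm L^2(\mu_\theta)$. $\widehat r_T$ is an estimator of the function $r(\cdot,\theta)$ based on $X_{(T)}$. Notation. $A'$ is the transpose, $A^{\times 2}=AA'$. The quadratic error of estimation of the regression function (QER) is $\rho_T(\theta)=\int_E \mathrm E_\theta\big(\widehat r_T(x)-r(x,\theta)\big)^{\times 2}\,d\mu_\theta(x)$, and the quadratic error of prediction (QEP) is $R_T(\theta)=\mathrm E_\theta\big(\widehat r_T(X_T)-r(X_T,\theta)\big)^{\times 2}$. LAN. The family $(\mathrm P^T_\theta,\theta\in\Theta)$ is LAN at $\theta$ with rate $c_T\to0$ ($c_T>0$) if there are a symmetric positive definite matrix $I(\theta)$ and random vectors $\Delta_T(\theta)$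 such that for all $u\in\mathbb R^d$, $\log\frac{d\mathrm P^T_{\theta+c_Tu}}{d\mathrm P^T_\theta}(X_{(T)})=u'\Delta_T(\theta)-\frac12u'I(\theta)u+\varepsilon_T(X_{(T)},\theta,u)$, where, under $\mathrm P_\theta^T$, $\Delta_T(\theta)$ converges in distribution to $\mathcal N(0,I(\theta))$ and $\varepsilon_T(X_{(T)},\theta,u)\to0$ in $\mathrm P_\theta$-probability as $T\to\infty$. (It is implicit that $\theta+c_Tu\in\Theta$ for $T$ large.) *)

(* Defs.v *)
From HB Require Import structures.
From mathcomp Require Import all_boot all_order all_algebra.
From mathcomp Require Import all_classical all_reals all_analysis.

Set Implicit Arguments.
Unset Strict Implicit.
Unset Printing Implicit Defensive.

Import Order.TTheory GRing.Theory Num.Theory.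
Import numFieldNormedType.Exports.

Local Open Scope classical_set_scope.
Local Open Scope ring_scope.

(* Matrices, hence the vectors 'cV[R]_n, carry the Borel sigma-algebra of their
   (sup norm) topology. *)
HB.instance Definition _ (R : realType) (m n : nat) :=
  @isMeasurable.Build (sigma_display (@open 'M[R]_(m, n))) 'M[R]_(m, n)
    <<s @open 'M[R]_(m, n) >> (@sigma_algebra0 _ setT _) (@sigma_algebraC _ _)
    (@sigma_algebra_bigcup _ setT _).

Section matrices.
Context {R : realType}.

Definition sqrmx_tr m n (A : 'M[R]_(m, n)) : 'M[R]_m := A *m A^T.

Definition sym_posdef n (S : 'M[R]_n) : Prop :=
  S^T = S /\ forall u : 'cV[R]_n, u != 0 -> 0 < (u^T *m S *m u) 0 0.

(* Fréchet differentiability relative to Theta, which need not be open; it is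
   the usual notion at the interior points of Theta. *)
Definition is_jacobian_within d k (Theta : set 'cV[R]_d)
    (f : 'cV[R]_d -> 'cV[R]_k) (theta : 'cV[R]_d) (J : 'M[R]_(k, d)) : Prop :=
  `|t - theta|^-1 *: (f t - f theta - J *m (t - theta))
    @[t --> within Theta theta^'] --> (0 : 'cV[R]_k).

End matrices.

(* Measurability for the trace sigma-algebra on D, with D itself not required
   to be measurable (the library's measurable_fun D f is vacuous otherwise). *)
Definition measurable_fun_trace d1 d2 (S : measurableType d1)
    (S' : measurableType d2) (D : set S) (f : S -> S') : Prop :=
  forall B, measurable B ->
    exists2 A, measurable A & D `&` f @^-1` B = D `&` A.

(* x |-> g x is a version of E(Y | X = x) *)
Definition is_regression dO dE (R : realType) (Omega : measurableType dO)
    (E : measurableType dE) k (P : probability Omega R)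
    (X : Omega -> E) (Y : Omega -> 'cV[R]_k) (g : E -> 'cV[R]_k) : Prop :=
  measurable_fun [set: E] g /\
  forall i : 'I_k,
    P.-integrable [set: Omega] (fun w => (Y w i 0)%:E) /\
    forall B : set E, measurable B ->
      (\int[P]_(w in X @^-1` B) (Y w i 0)%:E =
       \int[P]_(w in X @^-1` B) (g (X w) i 0)%:E)%E.

Section laws.
Context {R : realType}.

(* Cramér-Wold description of N(0, S); for S positive definite the variances
   u' S u, u != 0, do not vanish. normal_prob takes a standard deviation. *)
Definition is_centered_normal n (S : 'M[R]_n)
    (nu : probability 'cV[R]_n R) : Prop :=
  forall u : 'cV[R]_n, u != 0 -> forall B : set R, measurable B ->
    nu [set z | B ((u^T *m z) 0 0)] =
    normal_prob 0 (Num.sqrt ((u^T *m S *m u) 0 0)) B.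

Definition centered_finite_variance n (L : probability 'cV[R]_n R) : Prop :=
  forall i : 'I_n, (fun z : 'cV[R]_n => z i 0) \in Lfun L 2%:E /\
    ('E_L[fun z : 'cV[R]_n => (z i 0)%R] = 0)%E.

(* The density of the P-absolutely continuous part of Q in the Lebesgue
   decomposition of Q with respect to P, Q(. `&` N) being the singular part;
   if Q is dominated by P this is the Radon-Nikodym derivative dQ/dP. *)
Definition is_likelihood_ratio d (S : measurableType d)
    (Q P : probability S R) (f : S -> R) : Prop :=
  [/\ measurable_fun [set: S] f, (forall s, 0 <= f s) &
   exists N : set S, [/\ measurable N, P N = 0%E &
     forall A, measurable A ->
       Q A = (\int[P]_(s in A) (f s)%:E + Q (A `&` N))%E]].

(* Below, S T is the space of observations at time T and F describes
   "as T tends to infinity". *)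
Context {dS : R -> measure_display} {S : forall T, measurableType (dS T)}.
Variable F : set_system R.

Definition cvg_in_distribution n (Q : forall T, probability (S T) R)
    (Z : forall T, S T -> 'cV[R]_n) (L : probability 'cV[R]_n R) : Prop :=
  forall f : 'cV[R]_n -> R, continuous f -> bounded_fun f ->
    ('E_(Q T)[f \o Z T] @[T --> F] --> 'E_L[f])%E.

Definition cvg_in_probability0 (Q : forall T, probability (S T) R)
    (eps : forall T, S T -> \bar R) : Prop :=
  forall e : R, 0 < e ->
    Q T [set s | (e%:E <= `|eps T s|)%E] @[T --> F] --> 0%E.

(* P is total in the parameter, but its values outside Theta play no role:
   theta + c T *: u is in Theta for T large. The logarithm is lne, with
   lne 0 = -oo, so that the remainder is extended real valued. *)
Definition LAN d (Theta : set 'cV[R]_d)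
    (P : forall T, 'cV[R]_d -> probability (S T) R)
    (c : R -> R) (I : 'M[R]_d) (theta : 'cV[R]_d) : Prop :=
  [/\ sym_posdef I, c T @[T --> F] --> 0, (\forall T \near F, 0 < c T) &
   exists Delta : forall T, S T -> 'cV[R]_d,
   [/\ forall T, measurable_fun [set: S T] (Delta T),
       (exists2 nu, is_centered_normal I nu &
          cvg_in_distribution (fun T => P T theta) Delta nu) &
       forall u : 'cV[R]_d,
         (\forall T \near F, Theta (theta + c T *: u)) /\
         exists2 LR : forall T, S T -> R,
           (\forall T \near F,
              is_likelihood_ratio (P T (theta + c T *: u)) (P T theta) (LR T)) &
           cvg_in_probability0 (fun T => P T theta)
             (fun T s => (lne (LR T s)%:E -
                ((u^T *m Delta T s) 0 0
                 - 2^-1 * (u^T *m I *m u) 0 0)%R%:E)%E)]].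

End laws.

Section observed_path.
Context {R : realType} {dE : measure_display} (E : measurableType dE).
Variables (calT : set R) (T : R).

Definition obs_times : set R := [set t | calT t /\ 0 <= t <= T].

Definition cylinders : set (set (obs_times -> E)) :=
  [set A | exists t : obs_times, exists2 B : set E,
     measurable B & A = [set p | B (p t)]].

(* paths (x_t, t in calT, 0 <= t <= T) with the product sigma-algebra *)
Definition path_space := g_sigma_algebraType cylinders.

HB.instance Definition _ := Measurable.on path_space.

Context {dO : measure_display} {Omega : measurableType dO}.

(* Processes are indexed by all of R; only the times in calT are ever used. *)
Definition obs_path (X : R -> {mfun Omega >-> E}) (w : Omega) : path_space :=
  fun t => X (set_val t) w.

Lemma measurable_obs_path (X : R -> {mfun Omega >-> E}) :
  measurable_fun [set: Omega] (obs_path X).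
Proof.
apply: (@measurability _ _ Omega path_space setT (obs_path X) cylinders).
  by [].
move=> _ [_ [t [B mB ->]] <-].
rewrite setTI.
exact: (measurable_funPTI (X (set_val t)) mB).
Qed.

HB.instance Definition _ (X : R -> {mfun Omega >-> E}) :=
  isMeasurableFun.Build _ _ _ _ (obs_path X) (measurable_obs_path X).

(* the distribution of the path observed up to time T *)
Definition path_law (X : R -> {mfun Omega >-> E}) (P : probability Omega R) :
  probability path_space R := distribution P (obs_path X).

End observed_path.

Section errors.
Context {R : realType} {dO dE : measure_display}.
Context {Omega : measurableType dO} {E : measurableType dE} {k : nat}.
Variables (P : probability Omega R) (mu : {measure set E -> \bar R}).
Variables (XT : Omega -> E) (rT : Omega -> E -> 'cV[R]_k) (r : E -> 'cV[R]_k).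

Definition qer_coef (i j : 'I_k) : \bar R :=
  (\int[mu]_x 'E_P[fun w => sqrmx_tr (rT w x - r x)%R i j])%E.

Definition qer : 'M[R]_k := \matrix_(i, j) fine (qer_coef i j).

Definition qep_coef (i j : 'I_k) : \bar R :=
  'E_P[fun w => sqrmx_tr (rT w (XT w) - r (XT w))%R i j]%E.

Definition qep : 'M[R]_k := \matrix_(i, j) fine (qep_coef i j).

(* fine sends infinite values to 0: qer and qep are meaningful when finite *)
Definition qer_finite : Prop := forall i j, qer_coef i j \is a fin_num.
Definition qep_finite : Prop := forall i j, qep_coef i j \is a fin_num.

End errors.

(* Main.v *)
Require Import Defs.
From HB Require Import structures.
From mathcomp Require Import all_boot all_order all_algebra.
From mathcomp Require Import all_classical all_reals all_analysis.
From mathcomp Require Import measurable_realfun ring lra.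

Set Implicit Arguments.
Unset Strict Implicit.
Unset Printing Implicit Defensive.

Import Order.TTheory GRing.Theory Num.Theory.
Import numFieldNormedType.Exports.

Local Open Scope classical_set_scope.
Local Open Scope ring_scope.

(** Fix [theta], [y] and a point [x] at which the rescaled estimator
    has a regular limit law [L].  For a bounded [g] of the rescaled error, the
    inequality [g (w - 1) <= (g^2 + (w - 1)^2) / 2] applied to the likelihood
    ratio [w] of [theta + c u] with respect to [theta] bounds the increment of
    the mean of [g] (a chi-square bound in the manner of Hammersley, Chapman and
    Robbins).  LAN lets the truncated ratio be replaced by the log-normal
    variable [exp (u' Delta - u' I u / 2)], for which the mean of [(w - 1)^2] is
    [exp (u' I u) - 1], while regularity says that the increment tends to
    [E_L g(. + J u) - E_L g].  Taking for [g] a small multiple [t] of the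
    truncated linear form [y'z], letting the truncation level tend to infinity
    and then [t] to [0], one gets
      [y' J u <= l / 2 + u' I u / 2],
    where [l] is the lower limit of the rescaled mean square of [y'(rhat - r)];
    [u = I^-1 J' y] yields [y' J I^-1 J' y <= l].  Fatou's lemma along the
    integers integrates this in [x]; no joint weak limit, hence no tightness or
    Prokhorov argument, is needed. *)

(** * Densities and moments of likelihood ratios *)

Section density.
Context d (T : measurableType d) (R : realType).
Variables (mu nu : {measure set T -> \bar R}) (f : T -> R).
Hypotheses (mf : measurable_fun [set: T] f) (f0 : forall x, 0 <= f x).

Import HBNNSimple.

Let integral_nnsfun_density (h : {nnsfun T >-> R}) :
  (\int[mu]_x (h x * f x)%:E =
   \sum_(k \in range h) k%:E * \int[mu]_(x in h @^-1` [set k]) (f x)%:E)%E.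
Proof.
transitivity (\sum_(k \in range h)
    \int[mu]_x (k * (\1_(h @^-1` [set k]) x * f x))%:E)%E.
  rewrite -ge0_integral_fsum//; last 2 first.
  - move=> k; apply/measurable_EFinP; apply: measurable_funM => //.
    exact: measurable_funM.
  - move=> k x _; rewrite lee_fin mulrA mulr_ge0//.
    exact: nnfun_muleindic_ge0.
  apply: eq_integral => x _; rewrite fsumEFin//; congr EFin.
  rewrite {1}(fimfunE h) mulrC mulr_fsumr//.
  by apply: eq_fsbigr => k _ /=; ring.
apply: eq_fsbigr => k; rewrite inE => -[x _ <-].
under eq_integral do rewrite EFinM.
rewrite ge0_integralZl//.
- congr (_ * _)%E; rewrite [RHS]integral_mkcond; apply: eq_integral => y _.
  by rewrite epatch_indic muleC -EFinM mulrC.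
- by apply/measurable_EFinP; exact: measurable_funM.
- by move=> y _; rewrite lee_fin mulr_ge0.
- by rewrite lee_fin.
Qed.

Variable g : T -> R.
Hypotheses (mg : measurable_fun [set: T] g) (g0 : forall x, 0 <= g x).

Let mgE : measurable_fun [set: T] (EFin \o g).
Proof. exact/measurable_EFinP. Qed.

Let approx := nnsfun_approx measurableT mgE.

Let cvg_density :
  (\int[mu]_x (approx n x * f x)%:E @[n --> \oo] --> \int[mu]_x (g x * f x)%:E)%E.
Proof.
rewrite (_ : (\int[mu]_x (g x * f x)%:E)%E =
    (\int[mu]_x limn (fun n => (approx n x * f x)%:E))%E); last first.
  apply: eq_integral => x _; apply/esym/cvg_lim => //.
  under eq_fun do rewrite EFinM; rewrite EFinM; apply: cvgeZr => //.
  by apply: (cvg_nnsfun_approx measurableT mgE) => // y _; rewrite lee_fin.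
apply: cvg_monotone_convergence => //.
- by move=> n; apply/measurable_EFinP; exact: measurable_funM.
- by move=> n x _; rewrite lee_fin mulr_ge0.
- move=> x _ m n mn; rewrite lee_fin ler_wpM2r//.
  exact/lefP/nd_nnsfun_approx.
Qed.

Let cvg_nu :
  (\int[nu]_x (approx n x)%:E @[n --> \oo] --> \int[nu]_x (g x)%:E)%E.
Proof.
rewrite (_ : (\int[nu]_x (g x)%:E)%E =
    (\int[nu]_x limn (fun n => (approx n x)%:E))%E); last first.
  apply: eq_integral => x _; apply/esym/cvg_lim => //.
  by apply: (cvg_nnsfun_approx measurableT mgE) => // y _; rewrite lee_fin.
apply: cvg_monotone_convergence => //.
- by move=> n; exact/measurable_EFinP.
- by move=> n x _; rewrite lee_fin.
- by move=> x _ m n mn; rewrite lee_fin; exact/lefP/nd_nnsfun_approx.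
Qed.

Let integral_nnsfun_nu (h : {nnsfun T >-> R}) :
  (\int[nu]_x (h x)%:E = \sum_(k \in range h) k%:E * nu (h @^-1` [set k]))%E.
Proof.
rewrite integral_nnsfun// -sintegralE; congr (sintegral nu).
by apply/funext => x; rewrite patchE in_setT.
Qed.

(** Approximating [g] from below by simple functions reduces the claim to the level sets of the
    approximants. The one-sided form suits likelihood ratios, since [Q] may carry a singular part
    beyond its density. *)
Lemma ge0_integral_density_le :
  (forall A, measurable A -> (\int[mu]_(x in A) (f x)%:E <= nu A)%E) ->
  (\int[mu]_x (g x * f x)%:E <= \int[nu]_x (g x)%:E)%E.
Proof.
move=> h; apply: (lee_cvg_to cvg_density cvg_nu); apply: nearW => n.
rewrite integral_nnsfun_density integral_nnsfun_nu.
apply: lee_fsum => // _ [x _ <-].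
by rewrite lee_wpmul2l ?lee_fin//; apply: h.
Qed.

Lemma ge0_integral_density_ge :
  (forall A, measurable A -> (nu A <= \int[mu]_(x in A) (f x)%:E)%E) ->
  (\int[nu]_x (g x)%:E <= \int[mu]_x (g x * f x)%:E)%E.
Proof.
move=> h; apply: (lee_cvg_to cvg_nu cvg_density); apply: nearW => n.
rewrite integral_nnsfun_density integral_nnsfun_nu.
apply: lee_fsum => // _ [x _ <-].
by rewrite lee_wpmul2l ?lee_fin//; apply: h.
Qed.

End density.

(** * Exponential moments of the centered normal law *)

Section normal.
Context {R : realType}.
Implicit Type s : R.

Lemma ge0_integral_normal_prob s (g : R -> R) :
  measurable_fun [set: R] g -> (forall x, 0 <= g x) ->
  (\int[normal_prob 0 s]_x (g x)%:E =
   \int[lebesgue_measure]_x (g x * normal_pdf 0 s x)%:E)%E.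
Proof.
move=> mg g0; apply/eqP; rewrite eq_le; apply/andP; split.
- apply: ge0_integral_density_ge => //; first exact: measurable_normal_pdf.
  by move=> x; exact: normal_pdf_ge0.
- apply: ge0_integral_density_le => //; first exact: measurable_normal_pdf.
  by move=> x; exact: normal_pdf_ge0.
Qed.

(** Completing the square: the factor [expR (a * x)] turns the centered density into a constant
    multiple of the density with mean [a * s ^+ 2] and the same deviation, whose mass is 1. *)
Lemma normal_prob_mgf s (a : R) : s != 0 ->
  (\int[normal_prob 0 s]_x (expR (a * x))%:E =
   (expR (a ^+ 2 * s ^+ 2 / 2))%:E)%E.
Proof.
move=> s0.
rewrite ge0_integral_normal_prob//; last first.
  by apply: (measurableT_comp (@measurable_expR R)); exact: measurable_funM.
transitivity (\int[lebesgue_measure]_x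
   ((expR (a ^+ 2 * s ^+ 2 / 2))%:E * (normal_pdf (a * s ^+ 2) s x)%:E))%E.
  apply: eq_integral => x _; rewrite -EFinM; congr EFin.
  rewrite !normal_pdfE// mulrCA [RHS]mulrCA; congr *%R.
  by rewrite /normal_fun -!expRD; congr expR; field.
rewrite ge0_integralZl//.
- by rewrite integral_normal_pdf mule1.
- by apply/measurable_EFinP; exact: measurable_normal_pdf.
- by move=> x _; rewrite lee_fin; exact: normal_pdf_ge0.
Qed.

End normal.

Section real_integrable.
Context d (T : measurableType d) (R : realType).
Variables (mu : {measure set T -> \bar R}) (f g : T -> R).
Hypotheses (fi : mu.-integrable [set: T] (EFin \o f))
           (gi : mu.-integrable [set: T] (EFin \o g)).

Lemma integrable_addr : mu.-integrable [set: T] (EFin \o (fun x => f x + g x)).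
Proof. exact: (integrableD measurableT fi gi). Qed.

Lemma integrable_subr : mu.-integrable [set: T] (EFin \o (fun x => f x - g x)).
Proof. exact: (integrableB measurableT fi gi). Qed.

Lemma integrable_mulr (c : R) :
  mu.-integrable [set: T] (EFin \o (fun x => c * f x)).
Proof. exact: (integrableZl measurableT c fi). Qed.

Lemma EFin_Rintegral : (\int[mu]_x f x)%:E = (\int[mu]_x (f x)%:E)%E.
Proof. by rewrite /Rintegral fineK//; exact: integrable_fin_num. Qed.

End real_integrable.

Section bounded.
Context d (T : measurableType d) (R : realType) (P : probability T R).
Implicit Types f g : T -> R.

Lemma bounded_integrable f (M : R) : measurable_fun [set: T] f ->
  (forall x, `|f x| <= M) -> P.-integrable [set: T] (EFin \o f).
Proof.
move=> mf fM; apply: measurable_bounded_integrable => //=.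
  by rewrite (le_lt_trans (probability_le1 P measurableT))// ltry.
exists M; split; first exact: num_real.
by move=> x Mx y _; apply: le_trans (fM y) _; exact: ltW.
Qed.

Lemma expectation_Rintegral f : P.-integrable [set: T] (EFin \o f) ->
  'E_P[f]%E = (\int[P]_x f x)%:E.
Proof. by move=> fi; rewrite EFin_Rintegral// unlock. Qed.

Lemma Rintegral_prob_cst (c : R) : \int[P]_x c = c.
Proof.
by rewrite Rintegral_cst//; have /= -> := probability_setT P; rewrite mulr1.
Qed.

End bounded.

(** * Change of mean between two laws, through a truncated likelihood ratio *)

Section likelihood_ratio.
Context d (S : measurableType d) (R : realType) (P Q : probability S R).

(* What remains of [M - (M - g) w - g - g^2 / 2] once the cross term
   [g (w - 1)] is bounded by [(g^2 + (w - 1)^2) / 2]. *)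
Definition lr_gap (M w : R) : R := M * (1 - w) + 2^-1 * (w - 1) ^+ 2.

(** The difference of the gaps factors as [w - v] times [M + 1 - (v + w) / 2], and the second factor
    is at most [M + 1 + K] in absolute value. This will allow the ratio to be replaced by its
    log-normal approximation. *)
Lemma lr_gap_lip (M K v w : R) : 0 <= M -> 0 <= v <= K -> 0 <= w <= K ->
  lr_gap M v <= lr_gap M w + (M + 1 + K) * `|v - w|.
Proof.
move=> M0 /andP[v0 vK] /andP[w0 wK]; rewrite -lerBlDl.
have -> : lr_gap M v - lr_gap M w = (M + 1 - (v + w) / 2) * (w - v).
  by rewrite /lr_gap; field.
rewrite (le_trans (ler_norm _))// normrM (distrC w) ler_wpM2r// ler_norml.
by apply/andP; split; lra.
Qed.

Lemma measurable_lr_gap (M : R) (w : S -> R) : measurable_fun [set: S] w ->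
  measurable_fun [set: S] (fun s => lr_gap M (w s)).
Proof.
move=> mw; apply: measurable_funD.
  by apply: measurable_funM => //; apply: measurable_funB.
apply: measurable_funM => //; apply: measurable_funX.
exact: measurable_funB.
Qed.

Lemma lr_gap_bound (M K w : R) : 0 <= M -> 0 <= w <= K ->
  `|lr_gap M w| <= M * (1 + K) + (1 + K) ^+ 2.
Proof.
move=> M0 /andP[w0 wK]; rewrite (le_trans (ler_normD _ _))// lerD//.
  rewrite normrM (ger0_norm M0) ler_wpM2l// ler_norml.
  by apply/andP; split; lra.
by rewrite ger0_norm; [nra|rewrite mulr_ge0 ?invr_ge0 ?sqr_ge0].
Qed.

(** Passing from [g] to the nonnegative [M - g] gives both losses the same sign: truncating the
    ratio at [K] and dropping the singular part of [Q] can only decrease the integral of [M - g].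
    The rest is a pointwise inequality integrated under [P]. *)
Lemma likelihood_ratio_bound (LR g : S -> R) (M K : R) :
  is_likelihood_ratio Q P LR -> measurable_fun [set: S] g ->
  (forall s, `|g s| <= M) -> 0 <= K ->
  \int[Q]_s g s - \int[P]_s g s - 2^-1 * \int[P]_s (g s ^+ 2)
  <= \int[P]_s lr_gap M (Num.min (LR s) K).
Proof.
move=> [mLR LR0 [N [mN PN QE]]] mg gM K0.
have M0 : 0 <= M by rewrite (le_trans _ (gM point)).
pose W s := Num.min (LR s) K.
have mW : measurable_fun [set: S] W by exact: measurable_minr.
have W0 s : 0 <= W s by rewrite le_min LR0.
have WK s : W s <= K by rewrite ge_min lexx orbT.
have Mg0 s : 0 <= M - g s by rewrite subr_ge0 (le_trans (ler_norm _)).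
have mMg : measurable_fun [set: S] (fun s => M - g s) by exact: measurable_funB.
have ig (P' : probability S R) : P'.-integrable [set: S] (EFin \o g).
  exact: bounded_integrable gM.
have iMg : Q.-integrable [set: S] (EFin \o (fun s => M - g s)).
  apply: (@bounded_integrable _ _ _ _ _ (M + M)) => // s.
  by rewrite (le_trans (ler_normB _ _))// lerD// ger0_norm.
have iMgW : P.-integrable [set: S] (EFin \o (fun s => (M - g s) * W s)).
  apply: (@bounded_integrable _ _ _ _ _ ((M + M) * K)) => [|s].
    exact: measurable_funM.
  rewrite normrM ler_pM// ?(ger0_norm (W0 s))//.
  by rewrite (le_trans (ler_normB _ _))// lerD// ger0_norm.
have ig2 : P.-integrable [set: S] (EFin \o (fun s => g s ^+ 2)).
  apply: (@bounded_integrable _ _ _ _ _ (M ^+ 2)) => [|s].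
    exact: measurable_funX.
  by rewrite normrX ler_sqr ?nnegrE.
have igap : P.-integrable [set: S] (EFin \o (fun s => lr_gap M (W s))).
  apply: (@bounded_integrable _ _ _ _ _ (M * (1 + K) + (1 + K) ^+ 2)) => [|s].
    exact: measurable_lr_gap.
  by apply: lr_gap_bound => //; rewrite W0 WK.
have QP : \int[P]_s ((M - g s) * W s) <= \int[Q]_s (M - g s).
  rewrite -lee_fin !EFin_Rintegral//.
  apply: (@le_trans _ _ (\int[P]_s ((M - g s) * LR s)%:E)%E).
    apply: ge0_le_integral => //=.
    - by move=> s _; rewrite lee_fin mulr_ge0.
    - by apply/measurable_EFinP; exact: measurable_funM.
    - by apply/measurable_EFinP; exact: measurable_funM.
    - by move=> s _; rewrite lee_fin ler_wpM2l// ge_min lexx.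
  apply: ge0_integral_density_le => // A mA.
  by rewrite [leRHS](QE A mA) leeDl.
have ic (P' : probability S R) c : P'.-integrable [set: S] (EFin \o cst c).
  by apply: (@bounded_integrable _ _ _ _ _ `|c|).
move: QP; rewrite (@RintegralB _ _ _ _ _ (cst M)) ?Rintegral_prob_cst//;
  [move=> QP|exact: ic|exact: ig].
have hg2 : P.-integrable [set: S] (EFin \o (fun s => 2^-1 * g s ^+ 2)).
  exact: integrable_mulr.
have := @le_Rintegral _ _ _ P setT
  (fun s => M - (M - g s) * W s - g s - 2^-1 * g s ^+ 2)
  (fun s => lr_gap M (W s)) measurableT.
have i1 : P.-integrable [set: S] (EFin \o (fun s => M - (M - g s) * W s)).
  exact: integrable_subr (ic P M) iMgW.
have i2 : P.-integrable [set: S] (EFin \o (fun s => M - (M - g s) * W s - g s)).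
  exact: integrable_subr i1 (ig P).
have i3 : P.-integrable [set: S]
    (EFin \o (fun s => M - (M - g s) * W s - g s - 2^-1 * g s ^+ 2)).
  exact: integrable_subr i2 hg2.
rewrite (RintegralB measurableT i2 hg2) (RintegralB measurableT i1 (ig P)).
rewrite (RintegralB measurableT (ic P M) iMgW) (RintegralZl _ measurableT ig2).
rewrite Rintegral_prob_cst.
have h s : [set: S] s ->
    M - (M - g s) * W s - g s - 2^-1 * g s ^+ 2 <= lr_gap M (W s).
  move=> _; have := sqr_ge0 (g s - (W s - 1)); rewrite /lr_gap; nra.
move=> /(_ i3 igap h); lra.
Qed.

End likelihood_ratio.

Section continuous_matrix.
Context {R : realType}.

Lemma continuous_measurable_mx m n (f : 'M[R]_(m, n) -> R) :
  continuous f -> measurable_fun [set: 'M[R]_(m, n)] f.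
Proof.
move=> /continuousP cf; apply: (measurability _ (RGenOpens.measurableE R)).
move=> _ [_ [a [b ->] <-]]; rewrite setTI.
by apply: sub_sigma_algebra; apply: cf; exact: interval_open.
Qed.

Lemma continuous_dotmx n (u : 'cV[R]_n) :
  continuous (fun z : 'cV[R]_n => (u^T *m z) 0 0).
Proof.
have -> : (fun z : 'cV[R]_n => (u^T *m z) 0 0) =
    (fun z : 'cV[R]_n => \sum_i u i 0 * z i 0).
  by apply/funext => z; rewrite mxE; apply: eq_bigr => i _; rewrite mxE.
elim: (index_enum _) => [|i s IHs].
  have -> : (fun z : 'cV[R]_n => \sum_(i <- [::]) u i 0 * z i 0) = cst 0.
    by apply/funext => z; rewrite big_nil.
  exact: cst_continuous.
have -> : (fun z : 'cV[R]_n => \sum_(j <- i :: s) u j 0 * z j 0) =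
    (fun z => u i 0 * z i 0 + \sum_(j <- s) u j 0 * z j 0).
  by apply/funext => z; rewrite big_cons.
have ci : continuous (fun z : 'cV[R]_n => u i 0 * z i 0).
  move=> z; apply: continuousM; first exact: cst_continuous.
  exact: coord_continuous.
by move=> z; apply: (@continuousD R R^o _ _ _ z (ci z) (IHs z)).
Qed.

End continuous_matrix.

Lemma measurable_lne_EFin (R : realType) d (T : measurableType d) (f : T -> R) :
  measurable_fun [set: T] f ->
  measurable_fun [set: T] (fun x => lne (f x)%:E).
Proof.
move=> mf; rewrite /lne; apply: measurable_fun_ifT => //.
- by apply: measurable_fun_ler => //.
- by apply/measurable_EFinP; exact: (measurableT_comp (@measurable_ln R)).
Qed.

(** * Mean of the gap at a log-normal variable *)

Section normal_lr_gap.
Context {R : realType} n (I : 'M[R]_n) (nu : probability 'cV[R]_n R).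
Variable u : 'cV[R]_n.
Hypotheses (posI : sym_posdef I) (nuI : is_centered_normal I nu) (u0 : u != 0).

Let v := (u^T *m I *m u) 0 0.

Let v_gt0 : 0 < v. Proof. by have [_ h] := posI; exact: h. Qed.

Let mu_u : measurable_fun [set: 'cV[R]_n] (fun z : 'cV[R]_n => (u^T *m z) 0 0).
Proof. by apply: continuous_measurable_mx; exact: continuous_dotmx. Qed.

(** By the Cramér-Wold description, [u' z] is normal with variance [v] under [nu], so the integral
    is transported to the real line. *)
Lemma centered_normal_mgf (a : R) :
  (\int[nu]_z (expR (a * (u^T *m z) 0 0))%:E = (expR (a ^+ 2 * v / 2))%:E)%E.
Proof.
have s0 : Num.sqrt v != 0 by rewrite gt_eqF// sqrtr_gt0.
rewrite -[in RHS](sqr_sqrtr (ltW v_gt0)) -normal_prob_mgf//.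
have mexp : measurable_fun [set: measurableTypeR R]
    (fun x : measurableTypeR R => (expR (a * x))%:E).
  apply/measurable_EFinP; apply: (measurableT_comp (@measurable_expR R)).
  exact: measurable_funM.
have mu_u' : measurable_fun [set: 'cV[R]_n]
    (fun z : 'cV[R]_n => (u^T *m z) 0 0 : measurableTypeR R) := mu_u.
rewrite -[LHS](ge0_integral_pushforward mu_u' nu measurableT mexp)//.
by apply: eq_measure_integral => B mB _; exact: nuI.
Qed.

(** The variable [e = expR (u' z - v / 2)] has mean 1 and second moment [expR v]. Truncation is
    undone by [e - min(e, K) <= e ^+ 2 / K] in the linear term and, as [1 <= K], by
    [(min(e, K) - 1) ^+ 2 <= (e - 1) ^+ 2] in the quadratic one. *)
Lemma integral_lr_gap_normal (M K : R) : 0 <= M -> 1 <= K ->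
  \int[nu]_z lr_gap M (Num.min (expR ((u^T *m z) 0 0 - 2^-1 * v)) K)
  <= M * (expR v / K) + 2^-1 * (expR v - 1).
Proof.
move=> M0 K1.
have mgf_i (a : R) : nu.-integrable setT
    (EFin \o (fun z : 'cV[R]_n => expR (a * (u^T *m z) 0 0))).
  apply/integrableP; split.
    apply/measurable_EFinP; apply: (measurableT_comp (@measurable_expR R)).
    exact: measurable_funM.
  under eq_integral do rewrite /= ger0_norm ?expR_ge0//.
  by rewrite centered_normal_mgf ltry.
have mgfR (a : R) : \int[nu]_z expR (a * (u^T *m z) 0 0) = expR (a ^+ 2 * v / 2).
  by rewrite /Rintegral centered_normal_mgf.
pose f1 (z : 'cV[R]_n) := expR (1 * (u^T *m z) 0 0).
pose f2 (z : 'cV[R]_n) := expR (2 * (u^T *m z) 0 0).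
pose c1 := expR (- (2^-1 * v)).
pose c2 := expR (- v).
have c12 : c2 = c1 ^+ 2.
  by rewrite /c2 /c1 expr2 -expRD; congr expR; field.
have ic (c : R) : nu.-integrable setT (EFin \o (fun _ : 'cV[R]_n => c)).
  by apply: (@bounded_integrable _ _ _ _ _ `|c|).
have i1 (c : R) : nu.-integrable setT (EFin \o (fun z => c * f1 z)).
  exact: integrable_mulr (mgf_i 1) c.
have i2 (c : R) : nu.-integrable setT (EFin \o (fun z => c * f2 z)).
  exact: integrable_mulr (mgf_i 2) c.
(* As [e = c1 * f1] and [e ^+ 2 = c2 * f2], these are the coefficients of [f1] and [f2] in the
   majorant [M (1 - e + e ^+ 2 / K) + (e - 1) ^+ 2 / 2]. *)
pose a1 := - (M + 1) * c1; pose a2 := (M / K + 2^-1) * c2.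
have i3 := integrable_addr (i1 a1) (i2 a2).
have i4 := integrable_addr (ic (M + 2^-1)) i3.
have e1 : c1 * expR (1 ^+ 2 * v / 2) = 1.
  by rewrite /c1 -expRD -[RHS]expR0; congr expR; field.
have e2 : c2 * expR (2 ^+ 2 * v / 2) = expR v.
  by rewrite /c2 -expRD; congr expR; field.
have -> : M * (expR v / K) + 2^-1 * (expR v - 1) =
    \int[nu]_z (M + 2^-1 + (a1 * f1 z + a2 * f2 z)).
  rewrite (RintegralD measurableT (ic _) i3).
  rewrite (RintegralD measurableT (i1 a1) (i2 a2)).
  rewrite (RintegralZl _ measurableT (mgf_i 1)).
  rewrite (RintegralZl _ measurableT (mgf_i 2)).
  rewrite Rintegral_prob_cst !mgfR /a1 /a2 -(mulrA _ c1) e1 -(mulrA _ c2) e2.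
  by field; rewrite gt_eqF// (lt_le_trans ltr01).
apply: le_Rintegral => //.
- apply: (@bounded_integrable _ _ _ _ _ (M * (1 + K) + (1 + K) ^+ 2)) => [|z].
    apply: measurable_lr_gap; apply: measurable_minr => //.
    apply: (measurableT_comp (@measurable_expR R)).
    exact: measurable_funB.
  apply: lr_gap_bound => //; rewrite le_min expR_ge0 ge_min lexx orbT/= andbT.
  by rewrite (le_trans ler01).
- move=> z _.
  have K0 : 0 < K by rewrite (lt_le_trans ltr01).
  set w := (u^T *m z) 0 0.
  pose e := expR (w - 2^-1 * v).
  have -> : M + 2^-1 + (a1 * f1 z + a2 * f2 z) =
      M * (1 - e + e ^+ 2 / K) + 2^-1 * (e - 1) ^+ 2.
    have -> : a1 * f1 z = - (M + 1) * e.
      rewrite /a1 /f1 -mulrA -expRD -/w; congr (_ * expR _).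
      by field.
    have -> : a2 * f2 z = (M / K + 2^-1) * e ^+ 2.
      rewrite /a2 /f2 -mulrA -expRD expr2 -expRD -/w; congr (_ * expR _).
      by field.
    by field; rewrite gt_eqF.
  rewrite -/e; have e0 : 0 <= e by exact: expR_ge0.
  have ek0 : 0 <= e ^+ 2 / K by rewrite divr_ge0 ?sqr_ge0// ltW.
  rewrite /lr_gap; have [eK|Ke] := leP e K.
    by rewrite lerD// ler_wpM2l//; lra.
  apply: lerD.
    have : e <= e ^+ 2 / K by rewrite ler_pdivlMr// expr2 ler_wpM2l// ltW.
    by move=> ?; rewrite ler_wpM2l//; lra.
  by rewrite ler_wpM2l// ler_sqr ?nnegrE; lra.
Qed.

End normal_lr_gap.

(** * Means under local alternatives of a LAN family *)

Section lipschitz.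
Context {R : realType}.

(** For [a <= b], [expR a = expR b * expR (a - b)] is at least [m * (1 - (b - a))], where [m <= K]
    is the truncated larger value. A small LAN remainder on the logarithmic scale thus gives close
    truncated ratios. *)
Lemma min_expR_lip (K a b : R) : 0 <= K ->
  `|Num.min (expR a) K - Num.min (expR b) K| <= K * `|a - b|.
Proof.
move=> K0; wlog ab : a b / a <= b => [wlg|].
  have [|/ltW] := leP a b; first exact: wlg.
  by rewrite distrC (distrC a); exact: wlg.
rewrite !(distrC a) !(distrC (Num.min (expR a) K)).
rewrite (ger0_norm (_ : 0 <= b - a)) ?subr_ge0//.
set m := Num.min (expR b) K.
have m0 : 0 <= m by rewrite le_min expR_ge0.
have mK : m <= K by rewrite ge_min lexx orbT.
have mb : m <= expR b by rewrite ge_min lexx.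
have h : m - m * (b - a) <= expR a.
  have -> : expR a = expR b * expR (a - b) by rewrite -expRD addrC subrK.
  have h1 := expR_ge1Dx (a - b).
  have [h2|h2] := leP (1 + (a - b)) 0.
    apply: le_trans (_ : 0 <= _); last by rewrite mulr_ge0 ?expR_ge0.
    nra.
  have -> : m - m * (b - a) = m * (1 + (a - b)) by ring.
  by apply: ler_pM => //; exact: ltW.
rewrite ger0_norm; last first.
  by rewrite subr_ge0 le_min !ge_min ler_expR ab lexx orbT.
rewrite lerBlDl /Num.min; case: ifP => _; nra.
Qed.

Lemma continuous_lr_gap (M : R) : continuous (lr_gap M).
Proof.
move=> w; apply: cvgD; apply: cvgMl_tmp.
  by apply: cvgB; [exact: cvg_cst|exact: cvg_id].
apply: (cvg_comp (fun w : R => w - 1) (fun x : R => x ^+ 2)).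
  by apply: cvgB; [exact: cvg_id|exact: cvg_cst].
exact: exprn_continuous.
Qed.

End lipschitz.

Section limits.
Context {R : realType} {dS : R -> measure_display}.
Context {S : forall T, measurableType (dS T)}.
Variables (F : set_system R).
Context {FF : ProperFilter F}.

(** Real-valued form of the convergence of means. Measurability is asked along [F] because the
    estimators will be measurable at observation times. *)
Lemma cvg_in_distribution_Rintegral n (Q : forall T, probability (S T) R)
    (Z : forall T, S T -> 'cV[R]_n) (L : probability 'cV[R]_n R)
    (f : 'cV[R]_n -> R) (M : R) :
  cvg_in_distribution F Q Z L -> continuous f -> (forall z, `|f z| <= M) ->
  (\forall T \near F, measurable_fun [set: S T] (f \o Z T)) ->
  \int[Q T]_s f (Z T s) @[T --> F] --> \int[L]_z f z.
Proof.
move=> ZL cf fM mfZ; have mf := continuous_measurable_mx cf.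
have bf : bounded_fun f.
  exists M; split; first exact: num_real.
  by move=> x Mx y _; apply: le_trans (fM y) _; exact: ltW.
apply: fine_cvg; have := ZL f cf bf.
rewrite (expectation_Rintegral (bounded_integrable L mf fM)).
rewrite EFin_Rintegral; last exact: bounded_integrable fM.
by under eq_fun do rewrite unlock.
Qed.

(** [likelihood_ratio_bound] is applied at each [T], and [T] goes to infinity while the truncation
    level [K] and the tolerance [e] stay fixed. Both are chosen afterwards, to make the error terms
    arbitrarily small. *)
Lemma LAN_shift_bound d (Theta : set 'cV[R]_d)
    (P : forall T, 'cV[R]_d -> probability (S T) R) (c : R -> R) (I : 'M[R]_d)
    (theta u : 'cV[R]_d) (g : forall T, S T -> R) (M A B C : R) :
  LAN F Theta P c I theta -> u != 0 ->
  (forall T s, `|g T s| <= M) ->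
  (\forall T \near F, measurable_fun [set: S T] (g T)) ->
  \int[P T (theta + c T *: u)]_s g T s @[T --> F] --> A ->
  \int[P T theta]_s g T s @[T --> F] --> B ->
  \int[P T theta]_s (g T s ^+ 2) @[T --> F] --> C ->
  A - B - 2^-1 * C <= 2^-1 * (expR ((u^T *m I *m u) 0 0) - 1).
Proof.
move=> [posI _ _ [Delta [mDelta [nu nuI Dnu] lanu]]] u0 gM mg gA gB gC.
have [_ [LR isLR eps0]] := lanu u.
set v := (u^T *m I *m u) 0 0 in eps0 *.
have M0 : 0 <= M by rewrite (le_trans _ (gM 0 point)).
pose sd T s := (u^T *m Delta T s) 0 0 - 2^-1 * v.
have msd T : measurable_fun [set: S T] (sd T).
  apply: measurable_funB => //.
  apply: (measurableT_comp (f := fun z : 'cV[R]_d => (u^T *m z) 0 0)) => //.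
  by apply: continuous_measurable_mx; exact: continuous_dotmx.
(* The event on which the LAN remainder is at least [e]; its probability tends to 0. *)
pose far (e : R) T :=
  [set s : S T | (e%:E <= `|lne (LR T s)%:E - (sd T s)%:E|)%E].
have bound K e : 1 <= K -> 0 < e -> A - B - 2^-1 * C <=
    M * (expR v / K) + 2^-1 * (expR v - 1) + (M + 1 + K) * K * e.
  move=> K1 e0; have K0 : 0 <= K by rewrite (le_trans ler01).
  apply: (@le_trans _ _ (\int[nu]_z
      lr_gap M (Num.min (expR ((u^T *m z) 0 0 - 2^-1 * v)) K)
      + (M + 1 + K) * K * (e + 0))); last first.
    by rewrite addr0 lerD2r; exact: integral_lr_gap_normal.
  (* The truncation at [K] makes [phi] bounded as well as continuous, so the limit law of [Delta]
     applies to it. *)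
  pose phi (z : 'cV[R]_d) :=
    lr_gap M (Num.min (expR ((u^T *m z) 0 0 - 2^-1 * v)) K).
  have phiM z : `|phi z| <= M * (1 + K) + (1 + K) ^+ 2.
    by apply: lr_gap_bound => //; rewrite le_min expR_ge0 K0 ge_min lexx orbT.
  have cphi : continuous phi.
    move=> z; apply: (@continuous_comp _ _ _ (fun z : 'cV[R]_d =>
      Num.min (expR ((u^T *m z) 0 0 - 2^-1 * v)) K)).
      apply: (@continuous_min R); last exact: cst_continuous.
      apply: (@continuous_comp _ _ _ (fun z : 'cV[R]_d =>
        (u^T *m z) 0 0 - 2^-1 * v)); last exact: continuous_expR.
      apply: (@continuousB R R^o); last exact: cst_continuous.
      exact: continuous_dotmx.
    exact: continuous_lr_gap.
  have mphi T : measurable_fun [set: S T] (phi \o Delta T).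
    by apply: measurableT_comp => //; exact: continuous_measurable_mx.
  have lim_phi := cvg_in_distribution_Rintegral Dnu cphi phiM (nearW _ mphi).
  have lim_far : fine (P T theta (far e T)) @[T --> F] --> (0 : R).
    by apply: fine_cvg; exact: eps0.
  have limL : \int[P T (theta + c T *: u)]_s g T s - \int[P T theta]_s g T s
      - 2^-1 * \int[P T theta]_s (g T s ^+ 2) @[T --> F] --> A - B - 2^-1 * C.
    by apply: cvgB; [exact: cvgB|exact: cvgMl_tmp].
  have limR : \int[P T theta]_s phi (Delta T s)
      + (M + 1 + K) * K * (e + fine (P T theta (far e T))) @[T --> F]
      --> \int[nu]_z phi z + (M + 1 + K) * K * (e + 0).
    apply: cvgD; first exact: lim_phi.
    by apply: cvgMl_tmp; apply: cvgD; [exact: cvg_cst|exact: lim_far].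
  apply: (ler_cvg_to limL limR).
  near=> T.
  have mgT : measurable_fun [set: S T] (g T) by near: T.
  have LRT : is_likelihood_ratio (P T (theta + c T *: u)) (P T theta) (LR T).
    by near: T.
  apply: le_trans (likelihood_ratio_bound LRT mgT (gM T) K0) _.
  have [mLR LR0 _] := LRT.
  have mfar : measurable (far e T).
    rewrite -[far e T]setTI; apply: measurable_lee => //.
    apply: measurableT_comp => //; apply: emeasurable_funB.
      exact: measurable_lne_EFin.
    exact/measurable_EFinP.
  pose a := (M + 1 + K) * K.
  have a0 : 0 <= a by rewrite mulr_ge0//; lra.
  have i1 : (P T theta).-integrable setT (EFin \o (fun s => phi (Delta T s))).
    exact: bounded_integrable (mphi T) (fun s => phiM (Delta T s)).
  have i2 : (P T theta).-integrable setT (EFin \o cst (a * e)).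
    by apply: (@bounded_integrable _ _ _ _ _ `|a * e|).
  have ifar : (P T theta).-integrable setT (EFin \o \1_(far e T)).
    apply: (@bounded_integrable _ _ _ _ _ 1) => [|s].
      exact: measurable_indic.
    by rewrite indicE ger0_norm ?lern1 ?leq_b1.
  have i3 := integrable_mulr ifar a.
  have -> : fine (P T theta (far e T)) = \int[P T theta]_s \1_(far e T) s.
    by rewrite /Rintegral integral_indic// setIT.
  rewrite /cst mulrDr -[(M + 1 + K) * K * e](Rintegral_prob_cst (P T theta)).
  rewrite -(RintegralZl _ measurableT ifar) -(RintegralD measurableT i2 i3).
  rewrite -(RintegralD measurableT i1 (integrable_addr i2 i3)).
  apply: le_Rintegral => //.
  - apply: (@bounded_integrable _ _ _ _ _ (M * (1 + K) + (1 + K) ^+ 2)) => [|s].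
      by apply: measurable_lr_gap; exact: measurable_minr.
    by apply: lr_gap_bound => //; rewrite le_min LR0 K0 ge_min lexx orbT.
  - exact: integrable_addr i1 (integrable_addr i2 i3).
  - move=> s _.
    have lrK : 0 <= Num.min (LR T s) K <= K.
      by rewrite le_min LR0 K0 ge_min lexx orbT.
    have eK : 0 <= Num.min (expR (sd T s)) K <= K.
      by rewrite le_min expR_ge0 K0 ge_min lexx orbT.
    apply: le_trans (lr_gap_lip M0 lrK eK) _.
    rewrite lerD2l /= -mulrDr /a -mulrA ler_wpM2l//; first by lra.
    (* The two truncated values lie in [[0, K]], hence differ by at most [K] on [far]; off [far]
       their logarithms before truncation are within [e], and they differ by at most [K * e]. *)
    have [sfar|snfar] := pselect (far e T s).
      rewrite indicE mem_set//= ler_norml.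
      apply/andP; split; nra.
    rewrite indicE memNset//= addr0.
    have {snfar} : (`|lne (LR T s)%:E - (sd T s)%:E| < e%:E)%E.
      by rewrite ltNge; apply/negP.
    (* A vanishing ratio has logarithm [-oo], so the remainder would be infinite, which is excluded
       off [far]. *)
    have [LRs0|LRs0] := leP (LR T s) 0.
      by rewrite /lne LRs0 /= ltNge leey.
    rewrite lne_EFin// -EFinB /= lte_fin => lnlt.
    rewrite -[LR T s]lnK ?posrE//.
    by apply: le_trans (min_expR_lip _ _ K0) _; rewrite ler_wpM2l// ltW.
apply/ler_addgt0Pr => eta eta0.
(* This [K] makes the truncation error at most [eta / 2], and the tolerance
   [eta / 2 / ((M + 1 + K) * K)] makes the remainder term equal to [eta / 2]. *)
pose K := 1 + 2 * M * expR v / eta.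
have K1 : 1 <= K by rewrite lerDl !mulr_ge0 ?expR_ge0// invr_ge0 ltW.
have K0 : 0 < K by rewrite (lt_le_trans ltr01).
have a0 : 0 < (M + 1 + K) * K by rewrite mulr_gt0//; lra.
have e0 : 0 < eta / 2 / ((M + 1 + K) * K) by rewrite !divr_gt0.
apply: le_trans (bound _ _ K1 e0) _.
rewrite (mulrC _ (eta / 2 / _)) divfK ?gt_eqF//.
have : M * (expR v / K) <= eta / 2.
  rewrite mulrA ler_pdivrMr// /K mulrDr.
  have -> : eta / 2 * (2 * M * expR v / eta) = M * expR v.
    by field; rewrite gt_eqF.
  by rewrite lerDr mulr1 ltW// divr_gt0.
lra.
Unshelve. all: by end_near. Qed.

End limits.

Section integrable_sum.
Context d (T : measurableType d) (R : realType).
Variables (mu : {measure set T -> \bar R}) (I : Type) (f : I -> T -> R).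
Hypothesis fi : forall i, mu.-integrable [set: T] (EFin \o f i).

Lemma integrable_sumr (s : seq I) :
  mu.-integrable [set: T] (EFin \o (fun x => \sum_(i <- s) f i x)).
Proof.
elim: s => [|i s IHs].
  have -> : (fun x => \sum_(i <- [::]) f i x) = cst 0.
    by apply/funext => x; rewrite big_nil.
  exact: integrable0.
have -> : (fun x => \sum_(j <- i :: s) f j x) =
    (fun x => f i x + \sum_(j <- s) f j x).
  by apply/funext => x; rewrite big_cons.
exact: integrable_addr (fi i) IHs.
Qed.

Lemma Rintegral_sumr (s : seq I) :
  \int[mu]_x (\sum_(i <- s) f i x) = \sum_(i <- s) \int[mu]_x f i x.
Proof.
elim: s => [|i s IHs].
  rewrite big_nil -[RHS](mul0r (fine (mu [set: T]))) -Rintegral_cst//.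
  by apply: eq_Rintegral => x _; rewrite big_nil.
rewrite big_cons -IHs -(RintegralD measurableT (fi i) (integrable_sumr s)).
by apply: eq_Rintegral => x _; rewrite big_cons.
Qed.

End integrable_sum.

(** * Regular estimators *)

Section clamp.
Context {R : realType}.
Implicit Types N v w : R.

Definition clamp N v := Num.max (- N) (Num.min v N).

Lemma clamp_norm N v : 0 <= N -> `|clamp N v| <= N.
Proof.
move=> N0; rewrite ler_norml /clamp le_max lexx/= ge_max ge_min lexx orbT andbT.
lra.
Qed.

Lemma clamp_lip N v w : `|clamp N v - clamp N w| <= `|v - w|.
Proof.
have maxr_lip (a x y : R) : `|Num.max a x - Num.max a y| <= `|x - y|.
  rewrite ler_norml; case: (leP a x) => ax; case: (leP a y) => ay;
    case: (ler0P (x - y)) => xy; apply/andP; split; lra.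
have minr_lip (a x y : R) : `|Num.min x a - Num.min y a| <= `|x - y|.
  rewrite ler_norml; case: (leP x a) => ax; case: (leP y a) => ay;
    case: (ler0P (x - y)) => xy; apply/andP; split; lra.
exact: le_trans (maxr_lip _ _ _) (minr_lip _ _ _).
Qed.

(** The error vanishes for [|v| <= N] and is otherwise below [|v| <= v ^+ 2 / N]. Truncation is
    thereby controlled by second moments. *)
Lemma clamp_approx N v : 0 < N -> `|clamp N v - v| <= v ^+ 2 / N.
Proof.
move=> N0; rewrite ler_pdivlMr// /clamp.
have [vN|Nv] := leP v N.
  have [Nv|vN'] := leP (- N) v; first by rewrite subrr normr0 mul0r sqr_ge0.
  rewrite ger0_norm; nra.
have [NN|NN] := leP (- N) N; last by lra.
rewrite ler0_norm; nra.
Qed.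

Lemma clamp_sqr N v : 0 < N -> clamp N v ^+ 2 <= v ^+ 2.
Proof.
move=> N0; rewrite /clamp; have [vN|Nv] := leP v N.
  by have [Nv|vN'] := leP (- N) v => //; nra.
by have [NN|NN] := leP (- N) N; nra.
Qed.

Lemma continuous_clamp N : continuous (clamp N).
Proof.
move=> v; apply: (@continuous_max R R (cst (- N)) (fun v => Num.min v N)).
  exact: cst_continuous.
apply: (@continuous_min R R id (cst N)); first exact: cvg_id.
exact: cst_continuous.
Qed.

End clamp.

Section regular.
Context {R : realType} {dS : R -> measure_display}.
Context {S : forall T, measurableType (dS T)}.
Variables (F : set_system R).
Context {FF : ProperFilter F}.

Lemma centered_finite_variance_dotmx k (L : probability 'cV[R]_k R)
    (y : 'cV[R]_k) : centered_finite_variance L ->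
  [/\ L.-integrable setT (EFin \o (fun z : 'cV[R]_k => (y^T *m z) 0 0)),
      L.-integrable setT (EFin \o (fun z : 'cV[R]_k => (y^T *m z) 0 0 ^+ 2)) &
      \int[L]_z (y^T *m z) 0 0 = 0].
Proof.
move=> Lc; pose w (z : 'cV[R]_k) := (y^T *m z) 0 0.
have L1 : L [set: 'cV[R]_k] \is a fin_num.
  by have /= -> := probability_setT L.
have wE : w = fun z => \sum_(i < k) y i 0 * z i 0.
  by apply/funext => z; rewrite /w mxE; apply: eq_bigr => i _; rewrite mxE.
have w2E : (fun z => w z ^+ 2) = fun z => \sum_(i < k) \sum_(j < k)
    (y i 0 * y j 0) * (z i 0 * z j 0).
  apply/funext => z; rewrite wE expr2 mulr_suml; apply: eq_bigr => i _.
  by rewrite mulr_sumr; apply: eq_bigr => j _; ring.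
have iz i : L.-integrable setT (EFin \o (fun z : 'cV[R]_k => z i 0)).
  by apply/Lfun1_integrable; apply: Lfun_subset12 => //; exact: (Lc i).1.
have iyz i : L.-integrable setT (EFin \o (fun z : 'cV[R]_k => y i 0 * z i 0)).
  exact: integrable_mulr.
split.
- rewrite -/w wE; exact: integrable_sumr.
- rewrite w2E; apply: integrable_sumr => i; apply: integrable_sumr => j.
  apply: integrable_mulr; apply/Lfun1_integrable.
  exact: Lfun2_mul_Lfun1 (Lc i).1 (Lc j).1.
- rewrite -/w wE Rintegral_sumr// big1// => i _.
  rewrite (RintegralZl _ measurableT (iz i)).
  have := (Lc i).2; rewrite (expectation_Rintegral (iz i)) => -[->].
  by rewrite mulr0.
Qed.

(** The test function is [t] times the truncated form [y' z], for the shift [t *: u]. Every term is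
    then of order [t ^+ 2], and division by it as [t] tends to 0 linearizes the exponential; this is
    why regularity is asked along the whole ray. *)
Lemma LAN_regular_bound d k (Theta : set 'cV[R]_d)
    (P : forall T, 'cV[R]_d -> probability (S T) R) (c : R -> R) (I : 'M[R]_d)
    (theta u : 'cV[R]_d) (rh : forall T, S T -> 'cV[R]_k)
    (rf : 'cV[R]_d -> 'cV[R]_k) (Ju y : 'cV[R]_k)
    (L : probability 'cV[R]_k R) (l : R) :
  LAN F Theta P c I theta -> u != 0 ->
  (\forall T \near F, measurable_fun [set: S T] (rh T)) ->
  centered_finite_variance L ->
  (forall t : R, cvg_in_distribution F (fun T => P T (theta + c T *: (t *: u)))
     (fun T p => (c T)^-1 *: (rh T p - rf (theta + c T *: (t *: u)))) L) ->
  (forall t : R, (c T)^-1 *: (rf (theta + c T *: (t *: u)) - rf theta)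
     @[T --> F] --> t *: Ju) ->
  (forall N, 0 < N -> \int[L]_z (clamp N ((y^T *m z) 0 0) ^+ 2) <= l) ->
  (y^T *m Ju) 0 0 <= 2^-1 * l + 2^-1 * (u^T *m I *m u) 0 0.
Proof.
move=> lan u0 mrh Lc rhL rfJ hl.
have [iw iw2 w0] := centered_finite_variance_dotmx y Lc.
set b := (y^T *m Ju) 0 0; set v := (u^T *m I *m u) 0 0.
pose w (z : 'cV[R]_k) := (y^T *m z) 0 0.
pose V := \int[L]_z (w z ^+ 2).
have V0 : 0 <= V by apply: Rintegral_ge0 => z _; exact: sqr_ge0.
have cw : continuous w by exact: continuous_dotmx.
have mw : measurable_fun [set: 'cV[R]_k] w by exact: continuous_measurable_mx.
have ic (a : R) : L.-integrable setT (EFin \o (fun _ : 'cV[R]_k => a)).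
  by apply: (@bounded_integrable _ _ _ _ _ `|a|).
have wZB (a : R) z1 z2 : w (a *: (z1 - z2)) = a * (w z1 - w z2).
  by rewrite /w -scalemxAr mulmxBr !mxE.
have ipoly (c0 c1 c2 : R) : L.-integrable setT
    (EFin \o (fun z => c0 + (c1 * w z + c2 * w z ^+ 2))).
  apply: integrable_addr; first exact: ic.
  by apply: integrable_addr; exact: integrable_mulr.
have poly (c0 c1 c2 : R) :
    \int[L]_z (c0 + (c1 * w z + c2 * w z ^+ 2)) = c0 + c2 * V.
  rewrite (RintegralD measurableT (ic c0)
    (integrable_addr (integrable_mulr iw c1) (integrable_mulr iw2 c2))).
  rewrite (RintegralD measurableT (integrable_mulr iw c1)
    (integrable_mulr iw2 c2)).
  rewrite Rintegral_prob_cst (RintegralZl _ measurableT iw).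
  by rewrite (RintegralZl _ measurableT iw2) w0 mulr0 add0r.
(* The case [t = 0] of regularity gives the limit law under [theta] itself. *)
have rhL0 : cvg_in_distribution F (fun T => P T theta)
    (fun T p => (c T)^-1 *: (rh T p - rf theta)) L.
  move=> f cf bf; have := rhL 0 f cf bf.
  have e T : theta + c T *: (0 *: u) = theta.
    by rewrite scale0r scaler0 addr0.
  by under eq_fun => T do rewrite e.
have step t N : 0 < t -> 0 < N ->
    t ^+ 2 * b - t * (2 * V + (t * b) ^+ 2) / N - 2^-1 * t ^+ 2 * l
    <= 2^-1 * (expR (t ^+ 2 * v) - 1).
  move=> t0 N0.
  have tu0 : t *: u != 0 by rewrite scaler_eq0 gt_eqF.
  pose g T p := t * clamp N (w ((c T)^-1 *: (rh T p - rf theta))).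
  pose fB z := t * clamp N (w z).
  pose fA z := t * clamp N (w z + t * b).
  have tN (x : R) : `|t * clamp N x| <= t * N.
    by rewrite normrM gtr0_norm// ler_pM2l// clamp_norm// ltW.
  have gM T s : `|g T s| <= t * N by exact: tN.
  have mZ (a : R -> 'cV[R]_k) : \forall T \near F,
      measurable_fun [set: S T] (fun p => w ((c T)^-1 *: (rh T p - a T))).
    near=> T; have mrhT : measurable_fun [set: S T] (rh T) by near: T.
    have -> : (fun p => w ((c T)^-1 *: (rh T p - a T))) =
        (fun p => (c T)^-1 * (w (rh T p) - w (a T))).
      by apply/funext => p; rewrite wZB.
    apply: measurable_funM => //; apply: measurable_funB => //.
    exact: measurableT_comp.
  have mclamp (a : R) : measurable_fun [set: R] (fun x => t * clamp N (x + a)).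
    apply: measurable_funM => //.
    apply: (measurableT_comp (continuous_measurable_fun (@continuous_clamp R N))).
    exact: measurable_funD.
  have cfS (a : R) : continuous (fun z => t * clamp N (w z + a)).
    move=> z; apply: (@continuousM R _ (cst t) (fun z => clamp N (w z + a))).
      exact: cst_continuous.
    apply: (@continuous_comp _ _ _ (fun z => w z + a)); last exact: continuous_clamp.
    apply: (@continuousD R R^o _ w (cst a)); first exact: cw.
    exact: cst_continuous.
  have cfB : continuous fB.
    have -> : fB = (fun z => t * clamp N (w z + 0)).
      by apply/funext => z; rewrite addr0.
    exact: cfS.
  have cfB2 : continuous (fun z => fB z ^+ 2).
    move=> z; apply: (@continuous_comp _ _ _ fB (fun x => x ^+ 2)).
      exact: cfB.
    exact: exprn_continuous.
  have cfA : continuous fA by exact: cfS.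
  have mg : \forall T \near F, measurable_fun [set: S T] (g T).
    near=> T; have -> : g T = (fun p => t * clamp N
        (w ((c T)^-1 *: (rh T p - rf theta)) + 0)).
      by apply/funext => p; rewrite addr0.
    apply: (measurableT_comp (mclamp 0)).
    by near: T; exact: (mZ (fun=> rf theta)).
  have gB : \int[P T theta]_s g T s @[T --> F] --> \int[L]_z fB z.
    exact: (cvg_in_distribution_Rintegral rhL0 cfB (fun z => tN (w z)) mg).
  have gC : \int[P T theta]_s (g T s ^+ 2) @[T --> F] --> \int[L]_z (fB z ^+ 2).
    apply: (cvg_in_distribution_Rintegral rhL0 cfB2 (M := (t * N) ^+ 2)).
      by move=> z; rewrite normrX ler_sqr ?nnegrE ?tN// mulr_ge0 ?ltW.
    near=> T; apply: measurable_funX; near: T; exact: mg.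
  (* Under the shifted parameter, the error relative to [rf theta] is [Zt] plus a deterministic
     drift [dl] tending to [t *: Ju]. As [clamp] is 1-Lipschitz, replacing the drift by its limit
     costs at most [t * |w (dl T) - t * b|]. *)
  have gA : \int[P T (theta + c T *: (t *: u))]_s g T s @[T --> F]
      --> \int[L]_z fA z.
    pose dl T := (c T)^-1 *: (rf (theta + c T *: (t *: u)) - rf theta).
    pose Zt T p := (c T)^-1 *: (rh T p - rf (theta + c T *: (t *: u))).
    have mfA : \forall T \near F, measurable_fun [set: S T] (fA \o Zt T).
      near=> T; apply: (measurableT_comp (mclamp (t * b))).
      by near: T; exact: (mZ (fun T => rf (theta + c T *: (t *: u)))).
    have limA := cvg_in_distribution_Rintegral (rhL t) cfA (fun z => tN _) mfA.
    have limh : t * `|w (dl T) - t * b| @[T --> F] --> (0 : R).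
      have lim0 : w (dl T) - t * b @[T --> F] --> (0 : R).
        rewrite -(subrr (t * b)); apply: cvgB; last exact: cvg_cst.
        have <- : w (t *: Ju) = t * b by rewrite /w -scalemxAr mxE.
        exact: (continuous_cvg _ (cw _) (rfJ t)).
      have lim1 : `|w (dl T) - t * b| @[T --> F] --> (0 : R).
        by have h := cvg_norm lim0; rewrite normr0 in h; exact: h.
      by have h := cvgMl_tmp (a := t) lim1; rewrite mulr0 in h; exact: h.
    have hdiff T p : `|g T p - fA (Zt T p)| <= t * `|w (dl T) - t * b|.
      rewrite /g /fA -mulrBr normrM gtr0_norm// ler_pM2l//.
      apply: le_trans (clamp_lip _ _ _) _.
      rewrite opprD addrA (_ : w _ - w _ = w (dl T))//.
      by rewrite /Zt /dl !wZB; ring.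
    have ig T : measurable_fun [set: S T] (g T) ->
        (P T (theta + c T *: (t *: u))).-integrable setT (EFin \o g T).
      by move=> mgT; exact: bounded_integrable (gM T).
    have iA T : measurable_fun [set: S T] (fA \o Zt T) ->
        (P T (theta + c T *: (t *: u))).-integrable setT
        (EFin \o (fun p => fA (Zt T p))).
      by move=> mT; apply: (@bounded_integrable _ _ _ _ _ (t * N)) => // p; exact: tN.
    have ih T : (P T (theta + c T *: (t *: u))).-integrable setT
        (EFin \o (fun=> t * `|w (dl T) - t * b|)).
      exact: (@bounded_integrable _ _ _ _ _ (`|t * `|w (dl T) - t * b| |)).
    apply: (@squeeze_cvgr _ _ _ _
      (fun T => \int[P T (theta + c T *: (t *: u))]_p fA (Zt T p)
         - t * `|w (dl T) - t * b|)
      (fun T => \int[P T (theta + c T *: (t *: u))]_p fA (Zt T p)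
         + t * `|w (dl T) - t * b|)).
    - near=> T.
      have mgT : measurable_fun [set: S T] (g T) by near: T.
      have mAT : measurable_fun [set: S T] (fA \o Zt T) by near: T.
      rewrite -[t * `|_|](Rintegral_prob_cst (P T (theta + c T *: (t *: u)))).
      rewrite -(RintegralB measurableT (iA T mAT) (ih T)).
      rewrite -(RintegralD measurableT (iA T mAT) (ih T)).
      apply/andP; split; apply: le_Rintegral => //.
      - exact: integrable_subr (iA T mAT) (ih T).
      - exact: ig.
      - by move=> p _; have := hdiff T p; rewrite ler_norml => /andP[]; lra.
      - exact: ig.
      - exact: integrable_addr (iA T mAT) (ih T).
      - by move=> p _; have := hdiff T p; rewrite ler_norml => /andP[]; lra.
    - by have h := cvgB (limA FF) limh; rewrite subr0 in h; exact: h.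
    - by have h := cvgD (limA FF) limh; rewrite addr0 in h; exact: h.
  have {}gA := LAN_shift_bound lan tu0 gM mg gA gB gC; move: (gA FF) => {gA}.
  have -> : ((t *: u)^T *m I *m (t *: u)) 0 0 = t ^+ 2 * v.
    by rewrite [(t *: u)^T]linearZ/= -!scalemxAl -scalemxAr scalerA mxE -expr2.
  move=> bound; apply: le_trans bound.
  have iB : L.-integrable setT (EFin \o fB).
    apply: (@bounded_integrable _ _ _ _ _ (t * N)) => [|z]; last exact: tN.
    exact: continuous_measurable_mx.
  have iA : L.-integrable setT (EFin \o fA).
    apply: (@bounded_integrable _ _ _ _ _ (t * N)) => [|z]; last exact: tN.
    exact: continuous_measurable_mx.
  have C_le : \int[L]_z (fB z ^+ 2) <= t ^+ 2 * l.
    under eq_Rintegral do rewrite exprMn.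
    rewrite RintegralZl//; last first.
      apply: (@bounded_integrable _ _ _ _ _ (N ^+ 2)) => [|z].
        apply: measurable_funX; apply: measurableT_comp => //.
        exact: (continuous_measurable_fun (@continuous_clamp R N)).
      by rewrite normrX ler_sqr ?nnegrE ?clamp_norm// ltW.
    by rewrite ler_wpM2l ?sqr_ge0//; exact: hl.
  have B_le : \int[L]_z fB z <= t * V / N.
    have -> : t * V / N = 0 + t / N * V by rewrite add0r mulrAC.
    rewrite -(poly 0 t); apply: le_Rintegral => // z _.
    have := clamp_approx (w z) N0; rewrite ler_norml => /andP[_ h].
    rewrite add0r /fB -mulrA -mulrDr ler_pM2l//; lra.
  (* [clamp N x >= x - x ^+ 2 / N] at [x = w z + t * b] gives a quadratic polynomial in [w z], whose
     linear term has mean zero because [L] is centered. *)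
  have A_ge : t * (t * b) - t * (V + (t * b) ^+ 2) / N <= \int[L]_z fA z.
    have -> : t * (t * b) - t * (V + (t * b) ^+ 2) / N =
        t * (t * b) - t / N * (t * b) ^+ 2 + (- (t / N)) * V.
      by field; rewrite gt_eqF.
    rewrite -(poly _ (t - t / N * 2 * (t * b))); apply: le_Rintegral => // z _.
    have -> : t * (t * b) - t / N * (t * b) ^+ 2 + ((t - t / N * 2 * (t * b)) * w z
        + - (t / N) * w z ^+ 2) = t * (w z + t * b - (w z + t * b) ^+ 2 / N).
      by field; rewrite gt_eqF.
    have := clamp_approx (w z + t * b) N0; rewrite ler_norml => /andP[h _].
    rewrite /fA ler_pM2l//; lra.
  have -> : t * (2 * V + (t * b) ^+ 2) / N =
    t * V / N + t * (V + (t * b) ^+ 2) / N by field; rewrite gt_eqF.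
  lra.
have step2 t : 0 < t ->
    t ^+ 2 * b - 2^-1 * t ^+ 2 * l <= 2^-1 * (expR (t ^+ 2 * v) - 1).
  move=> t0; rewrite leNgt; apply/negP.
  set e := 2^-1 * (_ - 1); set x := _ - 2^-1 * _ * l => ex.
  pose D := t * (2 * V + (t * b) ^+ 2).
  have D0 : 0 <= D.
    apply: mulr_ge0; first exact: ltW.
    by apply: addr_ge0; [exact: mulr_ge0|exact: sqr_ge0].
  have xe0 : 0 < x - e by rewrite subr_gt0.
  (* At this level the truncation error [D / N] is less than the supposed excess [x - e], a
     contradiction. *)
  have N0 : 0 < 2 * (D + 1) / (x - e) by rewrite divr_gt0//; lra.
  have := step t _ t0 N0; rewrite -/D -/e.
  suff : D / (2 * (D + 1) / (x - e)) < x - e by rewrite /x; lra.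
  rewrite ltr_pdivrMr// mulrC divfK ?gt_eqF//; lra.
have v0 : 0 <= v by have [[_ vp] _ _ _] := lan; rewrite ltW// vp.
apply/ler_addgt0Pr => e e0.
(* With [t = a^-1 <= 1], the terms [2 * v] and [v ^+ 2 / e] of [a] ensure [2 * (t ^+ 2 * v) <= 1]
   and [t ^+ 2 * v ^+ 2 <= e]. *)
pose q := v ^+ 2 / e; have q0 : 0 <= q by rewrite divr_ge0 ?sqr_ge0// ltW.
pose a := 1 + 2 * v + q.
have a1 : 1 <= a by rewrite /a; lra.
have a0 : 0 < a by rewrite (lt_le_trans ltr01).
pose t := a^-1.
have t0 : 0 < t by rewrite invr_gt0.
have t1 : t <= 1 by rewrite invf_le1.
have tt : t ^+ 2 <= t by rewrite expr2 ler_piMr// ltW.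
have va : 2 * v <= a by rewrite /a; lra.
have ve : v ^+ 2 / e <= a by rewrite -/q /a; lra.
have tv : 2 * (t ^+ 2 * v) <= 1.
  apply: (@le_trans _ _ (t * (2 * v))); first by nra.
  by rewrite /t mulrC ler_pdivrMr// mul1r.
have tve : t ^+ 2 * v ^+ 2 <= e.
  apply: (@le_trans _ _ (t * v ^+ 2)); first by rewrite ler_wpM2r ?sqr_ge0.
  by rewrite /t mulrC ler_pdivrMr// mulrC -ler_pdivrMr.
have x0 : 0 <= t ^+ 2 * v by rewrite mulr_ge0 ?sqr_ge0.
(* From [expR (- x) >= 1 - x] and [(1 - x) (1 + x + 2 x ^+ 2) >= 1] for [0 <= x <= 1/2]. *)
have hx : expR (t ^+ 2 * v) - 1 <= t ^+ 2 * v + 2 * (t ^+ 2 * v) ^+ 2.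
  set x := t ^+ 2 * v in tv x0 *.
  have h := expR_ge1Dx (- x); have h2 : expR x * expR (- x) = 1.
    by rewrite -expRD subrr expR0.
  have := expR_gt0 x; nra.
have := step2 t t0.
have t20 : 0 < t ^+ 2 by rewrite exprn_gt0.
move=> h; rewrite -(ler_pM2l t20).
have : (t ^+ 2 * v) ^+ 2 <= t ^+ 2 * e.
  by rewrite exprMn expr2 -mulrA ler_pM2l.
lra.
Unshelve. all: by end_near. Qed.

End regular.

(** * Integrated quadratic errors *)

Section limn_einf.
Context {R : realType}.
Implicit Types (u : (\bar R)^nat) (a : R^nat) (A : R).

Lemma limn_einf_ge u a A : a n @[n --> \oo] --> A ->
  (\forall n \near \oo, ((a n)%:E <= u n)%E) -> (A%:E <= limn_einf u)%E.
Proof.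
move=> aA au; apply/lee_addgt0Pr => e e0.
rewrite -leeBlDr// -EFinB limn_einf_lim.
apply: lime_ge; first exact: is_cvg_einfs.
have [N _ Nau] : \forall n \near \oo, ((A - e)%:E <= u n)%E.
  near=> n; apply: (@le_trans _ _ (a n)%:E); last by near: n.
  rewrite lee_fin; near: n; apply: (cvgr_ge _ aA).
  by rewrite ltrBlDr ltrDl.
near=> n; apply: le_ereal_inf_tmp => _ [m /= nm <-]; apply: Nau => /=.
by apply: leq_trans nm; near: n; exact: nbhs_infty_ge.
Unshelve. all: by end_near. Qed.

Lemma limn_einf_eq u a A : a n @[n --> \oo] --> A ->
  (\forall n \near \oo, u n = (a n)%:E) -> limn_einf u = A%:E.
Proof.
move=> aA ua; have /cvg_limn_einf_sup[] // : u n @[n --> \oo] --> A%:E.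
have : (a n)%:E @[n --> \oo] --> A%:E.
  by apply: cvg_EFin; [exact: nearW|exact: aA].
apply: cvg_trans; apply: near_eq_cvg; near=> n; apply/esym.
by near: n.
Unshelve. all: by end_near. Qed.

End limn_einf.

Lemma quadratic_formE (R : comNzRingType) k (y : 'cV[R]_k) (A : 'M[R]_k) :
  (y^T *m A *m y) 0 0 = \sum_i \sum_j (y i 0 * y j 0) * A i j.
Proof.
rewrite mxE exchange_big; apply: eq_bigr => j _; rewrite mxE mulr_suml.
by apply: eq_bigr => i _; rewrite mxE; ring.
Qed.

(** * The QER matrix as an integrated scalar mean square *)

Section qer_quadratic.
Context {R : realType} {dO dE : measure_display}.
Context {Omega : measurableType dO} {E : measurableType dE} {k : nat}.
Variables (P : probability Omega R) (mu : {measure set E -> \bar R}).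
Variables (rT : Omega -> E -> 'cV[R]_k) (r : E -> 'cV[R]_k).
Hypothesis mrT : forall i,
  measurable_fun [set: Omega * E] (fun z => rT z.1 z.2 i 0).
Hypothesis mr : forall i, measurable_fun [set: E] (fun x => r x i 0).

Let D i w x := rT w x i 0 - r x i 0.

Let mDD i j :
  measurable_fun [set: Omega * E] (fun z => D i z.1 z.2 * D j z.1 z.2).
Proof.
have mD l : measurable_fun [set: Omega * E] (fun z => D l z.1 z.2).
  apply: measurable_funB; first exact: mrT.
  exact: (measurableT_comp (mr l)).
exact: measurable_funM.
Qed.

Let a i j x := (\int[P]_w (D i w x * D j w x)%:E)%E.
(** [fine] alters [a] only where it is infinite, which happens only outside [good], a null set. *)
Let b i j x := fine (a i j x).

Let mDDx i j x : measurable_fun [set: Omega] (fun w => D i w x * D j w x).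
Proof. exact: (measurableT_comp (mDD i j) (pair2_measurable x)). Qed.

Let ma i j : measurable_fun [set: E] (a i j).
Proof.
have mE : measurable_fun [set: Omega * E]
    (fun z => (D i z.1 z.2 * D j z.1 z.2)%:E).
  exact/measurable_EFinP.
(* The integrand is signed, so Tonelli measurability is applied to its positive and negative
   parts. *)
have -> : a i j = (fun x => fubini_G P (fun z => (D i z.1 z.2 * D j z.1 z.2)%:E)^\+ x
   - fubini_G P (fun z => (D i z.1 z.2 * D j z.1 z.2)%:E)^\- x)%E.
  apply/funext => x; rewrite /a integralE /fubini_G.
  by congr (_ - _)%E; apply: eq_integral => w _; rewrite unlock.
apply: emeasurable_funB.
- apply: measurable_fun_fubini_tonelli_G => [|z]; last exact: funepos_ge0.
  exact: measurable_funepos.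
- apply: measurable_fun_fubini_tonelli_G => [|z]; last exact: funeneg_ge0.
  exact: measurable_funeneg.
Qed.

Let mb i j : measurable_fun [set: E] (b i j).
Proof. by apply: measurableT_comp => //; exact: fine_measurable. Qed.

Let qer_coefE i j : qer_coef P mu rT r i j = (\int[mu]_x a i j x)%E.
Proof.
apply: eq_integral => x _; rewrite unlock; apply: eq_integral => w _.
by rewrite mxE big_ord1 !mxE.
Qed.

Hypothesis fin : qer_finite P mu rT r.

Let a_ge0 i x : (0 <= a i i x)%E.
Proof. by apply: integral_ge0 => w _; rewrite lee_fin -expr2 sqr_ge0. Qed.

Let ia i : mu.-integrable [set: E] (a i i).
Proof.
apply/integrableP; split => //.
under eq_integral do rewrite gee0_abs//.
by rewrite -qer_coefE -ge0_fin_numE ?fin// qer_coefE integral_ge0.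
Qed.

Let good x := forall i, a i i x \is a fin_num.

Let ae_good : {ae mu, forall x, good x}.
Proof.
apply: filter_forall => i; have := integrable_ae measurableT (ia i).
by apply: filterS => x /(_ I).
Qed.

(** The diagonal entries control the others, since a product is dominated by the sum of the two
    squares. *)
Let iDD i j x : good x ->
  P.-integrable [set: Omega] (EFin \o (fun w => D i w x * D j w x)).
Proof.
move=> gx.
have iD l : P.-integrable [set: Omega] (EFin \o (fun w => D l w x * D l w x)).
  apply/integrableP; split; first exact/measurable_EFinP.
  under eq_integral do rewrite /= -expr2 ger0_norm ?sqr_ge0// expr2.
  by have := gx l; rewrite ge0_fin_numE.
apply: (@le_integrable _ _ _ P setT measurableT _
  (EFin \o (fun w => D i w x * D i w x + D j w x * D j w x))).
- exact/measurable_EFinP.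
- move=> w _; rewrite /= lee_fin normrM.
  rewrite [leRHS]ger0_norm ?addr_ge0 -?expr2 ?sqr_ge0//.
  rewrite -[D i w x ^+ 2]real_normK ?num_real//.
  rewrite -[D j w x ^+ 2]real_normK ?num_real//.
  have := sqr_ge0 (`|D i w x| - `|D j w x|).
  have := normr_ge0 (D i w x); have := normr_ge0 (D j w x); nra.
- exact: integrable_addr.
Qed.

Let ib i j : mu.-integrable [set: E] (EFin \o b i j).
Proof.
apply: (@le_integrable _ _ _ mu setT measurableT _ (fun x => a i i x + a j j x)%E).
- exact/measurable_EFinP.
- move=> x _; rewrite [leRHS]gee0_abs; last by apply: adde_ge0; exact: a_ge0.
  rewrite /= /b.
  (* [fine] sends infinite values to 0, so this bound holds at every [x]. *)
  apply: (@le_trans _ _ `|a i j x|%E).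
    by case: (a i j x) => [s| |] //=; rewrite normr0 leey.
  have : (`|a i j x| <= \int[P]_w `|(D i w x * D j w x)%:E|)%E.
    by apply: le_abse_integral => //; exact/measurable_EFinP.
  move=> /le_trans; apply.
  rewrite /a -ge0_integralD//; last 4 first.
  - by move=> w _; rewrite lee_fin -expr2 sqr_ge0.
  - exact/measurable_EFinP.
  - by move=> w _; rewrite lee_fin -expr2 sqr_ge0.
  - exact/measurable_EFinP.
  apply: ge0_le_integral => //.
  - by apply: measurableT_comp => //; exact/measurable_EFinP.
  - by apply: emeasurable_funD; exact/measurable_EFinP.
  - move=> w _; rewrite /= -EFinD lee_fin normrM.
    rewrite -[D i w x * D i w x]expr2 -[D j w x * D j w x]expr2.
    rewrite -[D i w x ^+ 2]real_normK ?num_real//.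
    rewrite -[D j w x ^+ 2]real_normK ?num_real//.
    have := sqr_ge0 (`|D i w x| - `|D j w x|).
    have := normr_ge0 (D i w x); have := normr_ge0 (D j w x); nra.
- exact: integrableD.
Qed.

(** Finiteness of the diagonal of the QER makes all the cross products integrable, first in [w] for
    almost every [x] and then in [x]; the expanded square can be integrated term by term. *)
Lemma qer_quadratic (y : 'cV[R]_k) :
  (\int[mu]_x \int[P]_w ((y^T *m (rT w x - r x)) 0 0 ^+ 2)%:E =
   ((y^T *m qer P mu rT r *m y) 0 0)%:E)%E.
Proof.
have ie := integrable_sumr (fun i => integrable_sumr (fun j =>
   integrable_mulr (ib i j) (y i 0 * y j 0)) (index_enum 'I_k)) (index_enum 'I_k).
have sqrE w x : (y^T *m (rT w x - r x)) 0 0 ^+ 2 =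
    \sum_i \sum_j (y i 0 * y j 0) * (D i w x * D j w x).
  rewrite mxE expr2 mulr_suml; apply: eq_bigr => i _.
  by rewrite mulr_sumr; apply: eq_bigr => j _; rewrite /D !mxE; ring.
transitivity (\int[mu]_x (\sum_i \sum_j (y i 0 * y j 0) * b i j x)%:E)%E.
  apply: ae_eq_integral => //.
  - apply: (@measurable_fun_fubini_tonelli_G _ _ _ _ _ P
        (fun z => ((y^T *m (rT z.1 z.2 - r z.2)) 0 0 ^+ 2)%:E)) => [|z].
      apply/measurable_EFinP; under eq_fun do rewrite sqrE.
      apply: measurable_sum => i; apply: measurable_sum => j.
      exact: measurable_funM.
    by rewrite lee_fin sqr_ge0.
  - by have /integrableP[] := ie.
  - have := ae_good; apply: filterS => x gx _.
    under eq_integral do rewrite sqrE.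
    have ii i := integrable_sumr (fun j =>
      integrable_mulr (iDD i j gx) (y i 0 * y j 0)) (index_enum 'I_k).
    rewrite -EFin_Rintegral; last exact: integrable_sumr.
    congr EFin; rewrite (Rintegral_sumr ii); apply: eq_bigr => i _.
    rewrite (Rintegral_sumr (fun j =>
      integrable_mulr (iDD i j gx) (y i 0 * y j 0))); apply: eq_bigr => j _.
    by rewrite (RintegralZl _ measurableT (iDD i j gx)).
have -> : (\int[mu]_x (\sum_i \sum_j y i 0 * y j 0 * b i j x)%:E)%E =
    (\int[mu]_x (\sum_i \sum_j y i 0 * y j 0 * b i j x))%:E.
  by rewrite EFin_Rintegral.
congr EFin; rewrite quadratic_formE (Rintegral_sumr (fun i => integrable_sumr (fun j =>
   integrable_mulr (ib i j) (y i 0 * y j 0)) (index_enum 'I_k))).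
apply: eq_bigr => i _; rewrite (Rintegral_sumr (fun j =>
   integrable_mulr (ib i j) (y i 0 * y j 0))).
apply: eq_bigr => j _; rewrite (RintegralZl _ measurableT (ib i j)).
congr (_ * _); rewrite mxE qer_coefE /Rintegral; congr fine.
apply: ae_eq_integral => //; first exact/measurable_EFinP.
have := ae_good; apply: filterS => x gx _.
by rewrite /= /b fineK//; exact: integrable_fin_num (iDD i j gx).
Qed.

End qer_quadratic.

(** * The information form and differentiation along local parameters *)

Lemma cvg_to_within T U (f : T -> U) (F : set_system T) {FF : Filter F}
    (G : set_system U) (D : set U) :
  f x @[x --> F] --> G -> (\forall x \near F, D (f x)) ->
  f x @[x --> F] --> within D G.
Proof. by move=> fG fD A /fG; apply: filterS2 fD => x Dx; apply. Qed.

Lemma sym_posdef_unitmx (R : realType) n (S : 'M[R]_n) :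
  sym_posdef S -> S \in unitmx.
Proof.
move=> [_ posS]; rewrite unitmxE unitfE; apply/negP => /det0P[v v0 vS].
have := posS v^T; rewrite trmxK vS mul0mx mxE ltxx.
by rewrite -(inj_eq trmx_inj) trmxK linear0 => /(_ v0).
Qed.

(** This [u] maximizes [y' J u - u' S u / 2], and there [y' J u] and [u' S u] take the same
    value. *)
Lemma quadratic_form_invmx (R : realType) d k (S : 'M[R]_d) (J : 'M[R]_(k, d))
    (y : 'cV[R]_k) (u := invmx S *m J^T *m y) : sym_posdef S ->
  (y^T *m (J *m invmx S *m J^T) *m y) 0 0 = (u^T *m S *m u) 0 0.
Proof.
move=> posS; have symS : S^T = S by case: posS.
rewrite {1}/u !trmx_mul trmxK trmx_inv symS -(mulmxA _ _ S) mulmxKV.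
  by rewrite /u !mulmxA.
exact: sym_posdef_unitmx.
Qed.

Lemma rescaled_jacobian (R : realType) d k (Theta : set 'cV[R]_d)
    (f : 'cV[R]_d -> 'cV[R]_k) (theta u : 'cV[R]_d) (J : 'M[R]_(k, d))
    (T : Type) (F : set_system T) {FF : Filter F} (c : T -> R) :
  is_jacobian_within Theta f theta J ->
  c t @[t --> F] --> 0 -> (\forall t \near F, 0 < c t) ->
  (\forall t \near F, Theta (theta + c t *: u)) ->
  (c t)^-1 *: (f (theta + c t *: u) - f theta) @[t --> F] --> J *m u.
Proof.
(* For [u = 0] the points never leave [theta], which the punctured limit of [is_jacobian_within]
   excludes. Otherwise the increment has norm [c t * |u|], and the differential quotient is
   multiplied by [|u|]. *)
move=> fJ c0 cgt0 cTheta; have [->|u0] := eqVneq u 0.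
  under eq_fun do rewrite scaler0 addr0 subrr scaler0.
  by rewrite mulmx0; exact: cvg_cst.
pose h t := theta + c t *: u.
have h_theta : h t @[t --> F] --> theta.
  have e : theta = theta + 0 *: u by rewrite scale0r addr0.
  by rewrite [X in _ --> X]e; apply: cvgD; [exact: cvg_cst|exact: cvgZr_tmp].
have hw : h t @[t --> F] --> within Theta theta^'.
  apply: cvg_to_within => //; apply: cvg_to_within => //.
  near=> t; have ct : 0 < c t by near: t.
  by rewrite /h -subr_eq0 addrC addKr scaler_eq0 (negbTE u0) gt_eqF.
have lim0 := cvg_comp _ _ hw fJ.
have lim : `|u| *: (`|h t - theta|^-1 *: (f (h t) - f theta - J *m (h t - theta)))
    + J *m u @[t --> F] --> J *m u.
  rewrite -[X in _ --> X]add0r; apply: cvgD; last exact: cvg_cst.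
  by rewrite -(scaler0 _ `|u|); apply: cvgZl_tmp; exact: lim0.
apply: cvg_trans lim; apply: near_eq_cvg; near=> t.
have ct : 0 < c t by near: t.
have -> : h t - theta = c t *: u by rewrite /h addrC addKr.
rewrite normrZ (gtr0_norm ct) scalerA.
have -> : `|u| * (c t * `|u|)^-1 = (c t)^-1.
  by rewrite invfM mulrCA divff ?mulr1// normr_eq0.
by rewrite -scalemxAr scalerBr scalerA mulVf ?gt_eqF// scale1r subrK.
Unshelve. all: by end_near. Qed.

(** * Lower bound for the pointwise rescaled mean square *)

Section regular_liminf.
Context {R : realType} {dS : R -> measure_display}.
Context {S : forall T, measurableType (dS T)}.
Variables (F : set_system R).
Context {FF : ProperFilter F}.

(** The lower limit is taken along a sequence [tau] in view of Fatou's lemma. It serves as the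
    constant [l] of [LAN_regular_bound]. *)
Lemma LAN_regular_liminf d k (Theta : set 'cV[R]_d)
    (P : forall T, 'cV[R]_d -> probability (S T) R) (c : R -> R) (I : 'M[R]_d)
    (theta : 'cV[R]_d) (rh : forall T, S T -> 'cV[R]_k)
    (rf : 'cV[R]_d -> 'cV[R]_k) (J : 'M[R]_(k, d)) (y : 'cV[R]_k)
    (L : probability 'cV[R]_k R) (tau : nat -> R) :
  tau n @[n --> \oo] --> F ->
  LAN F Theta P c I theta ->
  is_jacobian_within Theta rf theta J ->
  (\forall T \near F, measurable_fun [set: S T] (rh T)) ->
  centered_finite_variance L ->
  (forall u : 'cV[R]_d, cvg_in_distribution F (fun T => P T (theta + c T *: u))
     (fun T p => (c T)^-1 *: (rh T p - rf (theta + c T *: u))) L) ->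
  (((y^T *m (J *m invmx I *m J^T) *m y) 0 0)%:E <=
   limn_einf (fun n => \int[P (tau n) theta]_p
     ((y^T *m ((c (tau n))^-1 *: (rh (tau n) p - rf theta))) 0 0 ^+ 2)%:E))%E.
Proof.
move=> tauF lan rfJ mrh Lc rhL; set l := limn_einf _.
pose w (z : 'cV[R]_k) := (y^T *m z) 0 0.
have cw : continuous w by exact: continuous_dotmx.
have mw : measurable_fun [set: 'cV[R]_k] w by exact: continuous_measurable_mx.
have [posI c0 cgt0 [Delta [_ _ lanu]]] := lan.
have rhL0 : cvg_in_distribution F (fun T => P T theta)
    (fun T p => (c T)^-1 *: (rh T p - rf theta)) L.
  move=> f cf bf; have := rhL 0 f cf bf.
  have e T : theta + c T *: 0 = theta by rewrite scaler0 addr0.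
  by under eq_fun => T do rewrite e.
have mZ : \forall T \near F, measurable_fun [set: S T]
    (fun p => w ((c T)^-1 *: (rh T p - rf theta))).
  near=> T; have mrhT : measurable_fun [set: S T] (rh T) by near: T.
  have -> : (fun p => w ((c T)^-1 *: (rh T p - rf theta))) =
      (fun p => (c T)^-1 * (w (rh T p) - w (rf theta))).
    by apply/funext => p; rewrite /w -scalemxAr mulmxBr !mxE.
  apply: measurable_funM => //; apply: measurable_funB => //.
  exact: measurableT_comp.
(* The truncated square is bounded and continuous, so its means converge, and it lies below the full
   square, whose means may diverge. *)
have clampL N : 0 < N -> ((\int[L]_z (clamp N (w z) ^+ 2))%:E <= l)%E.
  move=> N0.
  have cN : continuous (fun z => clamp N (w z) ^+ 2).
    move=> z; apply: (@continuous_comp _ _ _ (fun z => clamp N (w z))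
      (fun x => x ^+ 2)); last exact: exprn_continuous.
    by apply: (@continuous_comp _ _ _ w); [exact: cw|exact: continuous_clamp].
  have bN x : `|clamp N x ^+ 2| <= N ^+ 2.
    by rewrite normrX ler_sqr ?nnegrE ?clamp_norm// ltW.
  have mN : measurable_fun [set: R] (fun x => clamp N x ^+ 2).
    apply: measurable_funX.
    exact: (continuous_measurable_fun (@continuous_clamp R N)).
  have mNZ : \forall T \near F, measurable_fun [set: S T]
      ((fun z => clamp N (w z) ^+ 2) \o
       (fun p => (c T)^-1 *: (rh T p - rf theta))).
    near=> T; apply: (measurableT_comp mN); near: T; exact: mZ.
  have limN := cvg_in_distribution_Rintegral rhL0 cN (fun z => bN (w z)) mNZ.
  have limn : \int[P (tau n) theta]_p
      (clamp N (w ((c (tau n))^-1 *: (rh (tau n) p - rf theta))) ^+ 2)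
      @[n --> \oo] --> \int[L]_z (clamp N (w z) ^+ 2).
    exact: (cvg_comp _ _ tauF (limN FF)).
  apply: (limn_einf_ge limn).
  have mZtau : \forall n \near \oo, measurable_fun [set: S (tau n)]
      (fun p => w ((c (tau n))^-1 *: (rh (tau n) p - rf theta))) := tauF _ mZ.
  near=> n; have mZn : measurable_fun [set: S (tau n)]
      (fun p => w ((c (tau n))^-1 *: (rh (tau n) p - rf theta))) by near: n.
  have mNn := measurableT_comp mN mZn.
  rewrite EFin_Rintegral; last exact: bounded_integrable mNn (fun p => bN _).
  apply: ge0_le_integral => //.
  - by move=> p _; rewrite lee_fin sqr_ge0.
  - exact/measurable_EFinP.
  - by apply/measurable_EFinP; exact: measurable_funX.
  - by move=> p _; rewrite lee_fin clamp_sqr.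
pose u := invmx I *m J^T *m y.
have quE : (y^T *m (J *m invmx I *m J^T) *m y) 0 0 = (y^T *m (J *m u)) 0 0.
  by rewrite /u !mulmxA.
have vuE : (u^T *m I *m u) 0 0 = (y^T *m (J *m u)) 0 0.
  by rewrite -quE quadratic_form_invmx.
rewrite quE; have [u0|u0] := eqVneq u 0.
  rewrite u0 !mulmx0 mxE; apply: le_trans (clampL 1 ltr01).
  by rewrite lee_fin; apply: Rintegral_ge0 => z _; exact: sqr_ge0.
(* An infinite lower limit makes the claim trivial, and [-oo] contradicts [clampL]. *)
case: l clampL => [l| |] clampL; last 2 first.
- exact: leey.
- by have := clampL 1 ltr01; rewrite leNgt ltNyr.
have ucvg t : (c T)^-1 *: (rf (theta + c T *: (t *: u)) - rf theta)
    @[T --> F] --> t *: (J *m u).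
  rewrite (scalemxAr t J u); apply: (rescaled_jacobian (u := t *: u) rfJ c0 cgt0).
  by have [] := lanu (t *: u).
have clampR N : 0 < N -> \int[L]_z (clamp N (w z) ^+ 2) <= l.
  by move=> /clampL; rewrite lee_fin.
have := LAN_regular_bound lan u0 mrh Lc (fun t => rhL (t *: u)) ucvg clampR.
rewrite vuE lee_fin => /(_ FF); lra.
Unshelve. all: by end_near. Qed.

End regular_liminf.

Lemma cvg_quadratic_form (R : realType) k (y : 'cV[R]_k) T (F : set_system T)
    {FF : Filter F} (A : T -> 'M[R]_k) (M : 'M[R]_k) :
  A t @[t --> F] --> M ->
  (y^T *m A t *m y) 0 0 @[t --> F] --> (y^T *m M *m y) 0 0.
Proof.
move=> AM; rewrite quadratic_formE; under eq_fun do rewrite quadratic_formE.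
apply: (@cvg_big R^o) => [|i _]; first exact: add_continuous.
apply: (@cvg_big R^o) => [|j _]; first exact: add_continuous.
apply: cvgMl_tmp; exact: (continuous_cvg _ (@coord_continuous R k k i j M) AM).
Qed.

(** * Integration of the pointwise bound over the state space *)

Theorem corollary2p2 (R : realType) (d k : nat)
  (dO dE : measure_display)
  (Omega : measurableType dO) (E : measurableType dE)
  (calT : set R)
  (calTP : calT = range (fun n : nat => n%:R) \/ calT = [set t | 0 <= t])
  (Theta : set 'cV[R]_d)
  (P : 'cV[R]_d -> probability Omega R)
  (X : R -> {mfun Omega >-> E})
  (Y : R -> {mfun Omega >-> 'cV[R]_k})
  (mu : 'cV[R]_d -> {measure set E -> \bar R})
  (r : E -> 'cV[R]_d -> 'cV[R]_k)
  (J : E -> 'cV[R]_d -> 'M[R]_(k, d))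
  (rhat : forall T : R, path_space E calT T -> E -> 'cV[R]_k)
  (I : 'cV[R]_d -> 'M[R]_d)
  (r_regression : forall T theta, calT T -> Theta theta ->
     is_regression (P theta) (X T) (Y T) (r ^~ theta))
  (r_measurable :
     measurable_fun_trace ([set: E] `*` Theta)
       (fun z : E * 'cV[R]_d => r z.1 z.2))
  (r_jacobian : forall x theta, Theta theta ->
     is_jacobian_within Theta (r x) theta (J x theta))
  (r_L2 : forall theta, Theta theta -> forall i : 'I_k,
     (fun x => r x theta i 0) \in Lfun (mu theta) 2%:E)
  (J_L2 : forall theta, Theta theta -> forall (i : 'I_k) (j : 'I_d),
     (fun x => J x theta i j) \in Lfun (mu theta) 2%:E)
  (rhat_measurable : forall T, calT T ->
     measurable_fun [set: path_space E calT T * E]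
       (fun z : path_space E calT T * E => rhat T z.1 z.2))
  (lan : forall theta, Theta theta ->
     LAN (within calT +oo) Theta (fun T eta => path_law calT T X (P eta))
       (fun T => (Num.sqrt T)^-1) (I theta) theta)
  (rhat_regular : forall theta, Theta theta ->
     {ae mu theta, forall x, exists2 L : probability 'cV[R]_k R,
        centered_finite_variance L &
        forall u : 'cV[R]_d,
          cvg_in_distribution (within calT +oo)
            (fun T => path_law calT T X (P (theta + (Num.sqrt T)^-1 *: u)))
            (fun T p => Num.sqrt T *:
               (rhat T p x - r x (theta + (Num.sqrt T)^-1 *: u))) L})
  (qer_qep_limits : forall theta, Theta theta ->
     [/\ \forall T \near within calT +oo,
           qer_finite (P theta) (mu theta)
             (fun w => rhat T (obs_path X w)) (r ^~ theta),
         \forall T \near within calT +oo,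
           qep_finite (P theta) (X T)
             (fun w => rhat T (obs_path X w)) (r ^~ theta) &
         exists2 M : 'M[R]_k, M != 0 &
           (T *: qer (P theta) (mu theta)
              (fun w => rhat T (obs_path X w)) (r ^~ theta)
              @[T --> within calT +oo] --> M) /\
           (T *: qep (P theta) (X T)
              (fun w => rhat T (obs_path X w)) (r ^~ theta)
              @[T --> within calT +oo] --> M)]) :
  forall (theta : 'cV[R]_d) (y : 'cV[R]_k), Theta theta ->
    (y^T *m (\matrix_(i, j)
       (\int[mu theta]_x (J x theta *m invmx (I theta) *m (J x theta)^T) i j))
     *m y) 0 0
    <= lim (T * (y^T *m qep (P theta) (X T)
                   (fun w => rhat T (obs_path X w)) (r ^~ theta) *m y) 0 0
            @[T --> within calT +oo]).
Proof.
move=> theta y Ttheta; set F := within calT +oo.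
have calTn (n : nat) : calT n%:R.
  by case: calTP => ->; [exists n|rewrite /= ler0n].
(* The integers are observation times in discrete and in continuous time, so limits along [F] can be
   computed along them; this also makes [F] proper. *)
have natF : (n%:R : R) @[n --> \oo] --> F.
  by apply: cvg_to_within; [exact: cvgr_idn|exact: nearW].
have FF : ProperFilter F.
  apply: Build_ProperFilter_ex => A /natF => An.
  exact: filter_ex An.
have nearT : \forall T \near F, calT T by exact: near_withinT.
have rhat_sect T x : calT T ->
    measurable_fun [set: path_space E calT T] (fun p => rhat T p x).
  move=> cT.
  exact: (measurableT_comp (rhat_measurable T cT) (pair2_measurable x)).
have mr i : measurable_fun [set: E] (fun x => r x theta i 0).
  by have := r_L2 _ Ttheta i; rewrite inE => /andP[/[!inE]/=].
have mrhat n i : measurable_fun [set: Omega * E]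
    (fun z => rhat n%:R (obs_path X z.1) z.2 i 0).
  apply: (measurableT_comp (f := fun v : 'cV[R]_k => v i 0)).
    by apply: continuous_measurable_mx; exact: coord_continuous.
  apply: (measurableT_comp (rhat_measurable _ (calTn n))
    (g := fun z : Omega * E => (obs_path X z.1 : path_space E calT n%:R, z.2))).
  apply: measurable_fun_pair => //.
  exact: (measurableT_comp (@measurable_obs_path R dE E calT n%:R _ _ X)).
(* The two rescaled errors share the limit [M], so the bound for the prediction error is obtained
   from the regression error. *)
have [qer_fin _ [M _ [qerM qepM]]] := qer_qep_limits _ Ttheta.
pose qer_ T :=
  qer (P theta) (mu theta) (fun w => rhat T (obs_path X w)) (r ^~ theta).
have lim_qep := cvg_quadratic_form (y := y) qepM.
have -> : lim (T * (y^T *m qep (P theta) (X T)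
    (fun w => rhat T (obs_path X w)) (r ^~ theta) *m y) 0 0 @[T --> F]) =
    (y^T *m M *m y) 0 0.
  apply: (cvg_lim (@Rhausdorff R)); apply: cvg_trans (lim_qep FF).
  apply: near_eq_cvg; apply: nearW => T.
  by rewrite -scalemxAr -scalemxAl mxE.
have posI : sym_posdef (I theta) by have [] := lan _ Ttheta.
pose K x := J x theta *m invmx (I theta) *m (J x theta)^T.
pose q x := (y^T *m K x *m y) 0 0.
have iK i j : (mu theta).-integrable [set: E] (EFin \o (fun x => K x i j)).
  have -> : (fun x => K x i j) = (fun x => \sum_b \sum_a
      invmx (I theta) a b * (J x theta i a * J x theta j b)).
    apply/funext => x; rewrite mxE; apply: eq_bigr => b _.
    rewrite mxE mulr_suml; apply: eq_bigr => a _; rewrite mxE; ring.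
  apply: integrable_sumr => b; apply: integrable_sumr => a.
  apply: integrable_mulr; apply/Lfun1_integrable.
  by apply: Lfun2_mul_Lfun1; exact: J_L2.
have iyK i j := integrable_mulr (iK i j) (y i 0 * y j 0).
have qE : q = (fun x => \sum_i \sum_j (y i 0 * y j 0) * K x i j).
  by apply/funext => x; rewrite /q quadratic_formE.
have iq : (mu theta).-integrable [set: E] (EFin \o q).
  by rewrite qE; apply: integrable_sumr => i; exact: integrable_sumr.
have q0 x : 0 <= q x.
  rewrite /q quadratic_form_invmx//.
  set u := invmx _ *m _ *m _; have [->|u0] := eqVneq u 0.
    by rewrite mulmx0 mxE.
  by case: posI => _ /(_ _ u0)/ltW.
have -> : (y^T *m (\matrix_(i, j) (\int[mu theta]_x K x i j)) *m y) 0 0 =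
    \int[mu theta]_x q x.
  rewrite quadratic_formE qE Rintegral_sumr => [|i]; last exact: integrable_sumr.
  apply: eq_bigr => i _; rewrite Rintegral_sumr//; apply: eq_bigr => j _.
  by rewrite mxE (RintegralZl _ measurableT (iK i j)).
pose e n x := (n%:R%:E * \int[P theta]_w
  ((y^T *m (rhat n%:R (obs_path X w) x - r x theta)) 0 0 ^+ 2)%:E)%E.
pose e1 n (z : Omega * E) :=
  ((y^T *m (rhat n%:R (obs_path X z.1) z.2 - r z.2 theta)) 0 0 ^+ 2)%:E.
have me1 n : measurable_fun [set: Omega * E] (e1 n).
  apply/measurable_EFinP; apply: measurable_funX.
  under eq_fun do rewrite mxE.
  apply: measurable_sum => i; apply: measurable_funM => //.
  under eq_fun do rewrite !mxE.
  by apply: measurable_funB; [exact: mrhat|exact: (measurableT_comp (mr i))].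
have mint n : measurable_fun [set: E]
    (fun x => (\int[P theta]_w e1 n (w, x))%E).
  apply: (@measurable_fun_fubini_tonelli_G _ _ _ _ _ (P theta) (e1 n)) => // z.
  by rewrite lee_fin sqr_ge0.
have me n : measurable_fun [set: E] (e n).
  by apply: measurable_funeM; exact: mint.
have int_ge0 n x : (0 <= \int[P theta]_w e1 n (w, x))%E.
  by apply: integral_ge0 => w _; rewrite lee_fin sqr_ge0.
have e_ge0 n x : (0 <= e n x)%E by apply: mule_ge0 => //; exact: int_ge0.
have q_le_e : {ae mu theta, forall x, [set: E] x ->
    ((q x)%:E <= limn_einf (e ^~ x))%E}.
  have := rhat_regular _ Ttheta; apply: filterS => x [L Lc rhL] _.
  have meas : \forall T \near F,
      measurable_fun [set: path_space E calT T] (fun p => rhat T p x).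
    by move: nearT; apply: filterS => T cT; exact: rhat_sect.
  have rhL' u : cvg_in_distribution F
      (fun T => path_law calT T X (P (theta + (Num.sqrt T)^-1 *: u)))
      (fun T p => (Num.sqrt T)^-1^-1 *:
         (rhat T p x - r x (theta + (Num.sqrt T)^-1 *: u))) L.
    move=> f cf bf; have := rhL u f cf bf.
    by under [in X in _ -> X]eq_fun do rewrite invrK.
  have := LAN_regular_liminf y natF (lan _ Ttheta) (r_jacobian x _ Ttheta)
    meas Lc rhL'.
  (* The mean under the path law is carried back to [Omega], and the squared scale [Num.sqrt n%:R]
     becomes the factor [n] of [e]. *)
  move=> /(_ FF); congr (_ <= limn_einf _)%E; apply/funext => n.
  rewrite /e -ge0_integralZl//; last 2 first.
  - have := measurableT_comp (me1 n) (pair2_measurable x); exact.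
  - by move=> w _; rewrite lee_fin sqr_ge0.
  rewrite ge0_integral_distribution//; last 2 first.
  - apply/measurable_EFinP; apply: measurable_funX.
    apply: (eq_measurable_fun (fun p => (Num.sqrt n%:R)^-1^-1 *
      ((y^T *m rhat n%:R p x) 0 0 - (y^T *m r x theta) 0 0))) => [p _|].
      by rewrite -scalemxAr mulmxBr !mxE.
    apply: measurable_funM => //; apply: measurable_funB => //.
    apply: (measurableT_comp (f := fun v : 'cV[R]_k => (y^T *m v) 0 0)).
      by apply: continuous_measurable_mx; exact: continuous_dotmx.
    exact: rhat_sect.
  - by move=> p; rewrite lee_fin sqr_ge0.
  apply: eq_integral => w _ /=; rewrite invrK -EFinM; congr EFin.
  by rewrite -scalemxAr mxE exprMn sqr_sqrtr ?ler0n.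
(* For [n] large the QER is finite and these integrals are the quadratic forms of [n] times the QER,
   so their lower limit is a genuine limit. *)
have lim_e : limn_einf (fun n => \int[mu theta]_x e n x)%E =
    ((y^T *m M *m y) 0 0)%:E.
  have lim_qer : (y^T *m (n%:R *: qer_ n%:R) *m y) 0 0 @[n --> \oo] -->
      (y^T *m M *m y) 0 0.
    by apply: cvg_quadratic_form; exact: (cvg_comp _ _ natF qerM).
  have fin_nat : \forall n \near \oo, qer_finite (P theta) (mu theta)
      (fun w => rhat n%:R (obs_path X w)) (r ^~ theta) := natF _ qer_fin.
  apply: (limn_einf_eq lim_qer); apply: filterS fin_nat => n fin_n.
  rewrite ge0_integralZl//.
  - rewrite (qer_quadratic (mrhat n) mr fin_n) -EFinM; congr EFin.
    by rewrite -scalemxAr -scalemxAl [RHS]mxE.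
  - exact: mint.
  - by move=> x _; exact: int_ge0.
rewrite -lee_fin EFin_Rintegral// -lim_e.
(* Fatou's lemma puts the lower limit inside the integral, where [q_le_e] bounds it below almost
   everywhere. *)
apply: le_trans (fatou (mu theta) measurableT me (fun n x _ => e_ge0 n x)).
apply: ae_ge0_le_integral => //.
- by move=> x _; rewrite lee_fin.
- by have /integrableP[] := iq.
- move=> x _; rewrite limn_einf_lim.
  apply: lime_ge; first exact: is_cvg_einfs.
  by apply: nearW => n; apply: le_ereal_inf_tmp => _ [m _ <-].
- apply: measurableT_comp => //.
  apply: (measurable_fun_limn_esup (f := fun n x => (- e n x)%E)) => // n.
  exact: measurableT_comp.
Qed.
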